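(* For $\mathfrak g=SKO(n,n+1;\lambda,\underline t)$, $$\dim\mathfrak g=2\Big(\sum_{l=2}^n\Big((2^{n-1}-2^{n-l})\sum_{(i_1,\dots,i_l)\in\mathbf J(l)}\prod_{c=1}^l\pi_{i_c}\Big)+\prod_{j=1}^n(\pi_j+2)\Big)-\sum_{k\in\mathfrak S_2(\lambda,n)}\binom nk-2^n-\delta'_{n\lambda,-1}.$$
   Context: Setting. $\mathbb F$ is a field of characteristic $p>3$, $n\ge 3$ is an integer, $\underline t=(t_1,\dots,t_n)$ is a tuple of positive integers, $\lambda\in\mathbb F$. Put $\pi_i=p^{t_i}-1$, $\mathbb A=\{\alpha\in\mathbb N_0^n:\alpha_i\le\pi_i\ \forall i\}$, and let $\varepsilon_i$ be the $i$-th unit vector. $\mathcal O(n;\underline t)$ is the divided power algebra with basis $x^{(\alpha)}$, $\alpha\in\mathbb A$, and product $x^{(\alpha)}x^{(\beta)}=\binom{\alpha+\beta}{\alpha}x^{(\alpha+\beta)}$ (with $x^{(\gamma)}=0$ if $\gamma\notin\mathbb A$); $x_i:=x^{(\varepsilon_i)}$. $\mathcal O=\mathcal O(n;\underline t)\otimes\Lambda$, where $\Lambda$ is the exterior superalgebra in odd variables $x_{n+1},\dots,x_{2n+1}$; $\mathrm p(a)\in\mathbb Z_2$ is the parity, and formulas involving $\mathrm p(a)$ are stated for homogeneous $a$ and extended linearly. $\partial_r$ ($1\le r\le 2n+1$) is the superderivation of $\mathcal O$ (even for $r\le n$, odd for $r>n$) with $\partial_r(x^{(\alpha)})=x^{(\alpha-\varepsilon_r)}$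 for $r\le n$ and $\partial_r(x_s)=\delta_{rs}$. Put $i'=i+n$ for $1\le i\le n$, $i'=i-n$ for $n+1\le i\le 2n$; $\mu(i)=0$ for $i\le n$ and $\mu(i)=1$ for $n+1\le i\le 2n+1$; $\mathfrak D=\sum_{i=1}^{2n}x_i\partial_i$; $\Delta=\sum_{i=1}^n\partial_i\partial_{i'}$. For $a\in\mathcal O$ let $T_H(a)=\sum_{i=1}^{2n}(-1)^{\mu(i')\mathrm p(a)}\partial_{i'}(a)\partial_i$, $D_{KO}(a)=T_H(a)+(-1)^{\mathrm p(a)}\partial_{2n+1}(a)\mathfrak D+(\mathfrak D(a)-2a)\partial_{2n+1}$, and $\mathrm{div}_\lambda(a)=(-1)^{\mathrm p(a)}2\big(\Delta(a)+(\mathfrak D-n\lambda\,\mathrm{id})\partial_{2n+1}(a)\big)$. Then $KO(n,n+1;\underline t)=\{D_{KO}(a):a\in\mathcal O\}$ is a Lie superalgebra of superderivations of $\mathcal O$, and $\mathfrak g''=SKO''(n,n+1;\lambda,\underline t)=\{D_{KO}(a):a\in\mathcal O,\ \mathrm{div}_\lambda(a)=0\}$ is a subalgebra. Put $\mathfrak g'=[\mathfrak g'',\mathfrak g'']$ and $\mathfrak g=SKO(n,n+1;\lambda,\underline t)=[\mathfrak g',\mathfrak g']$. $\mathbf J(l)=\{(i_1,\dots,i_l):1\le i_1<\dots<i_l\le n\}$; $\mathfrak S_2(\lambda,n)=\{k\in\{0,1,\dots,n\}:n\lambda-n+2k+2=0\text{ in }\mathbb F\}$; $\delta'_{n\lambda,-1}=1$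 if $n\lambda+1=0$ in $\mathbb F$ and $0$ otherwise. *)

(* Defs.v *)
From HB Require Import structures.
From mathcomp Require Import all_boot all_order all_algebra.

Set Implicit Arguments.
Unset Strict Implicit.
Unset Printing Implicit Defensive.

Import GRing.Theory.
Local Open Scope ring_scope.

Section Superalgebra.

Variables (F : fieldType) (p n : nat) (t : 'I_n -> nat).

Definition height (i : 'I_n) : nat := (p ^ t i).-1.

(* The basis monomials of O: a pair (alpha, S) stands for x^(alpha) x_S, with  *)
(* alpha_i <= height i, where x_S is the product of the x_(n+1+s), s \in S,    *)
(* taken in increasing order of s.                                             *)
Definition mono : finType :=
  ({dffun forall i : 'I_n, 'I_(height i).+1} * {set 'I_n.+1})%type.

(* An element of O is its family of coefficients on this basis.                *)
Definition superO : vectType F := {ffun mono -> F^o}.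

Definition coef (a : superO) (u : mono) : F := (a : {ffun mono -> F^o}) u.

Definition expo (u : mono) (i : 'I_n) : nat := u.1 i.

(* x^(gamma) x_S for arbitrary gamma: it is 0 as soon as gamma_i > height i    *)
(* for some i.                                                                 *)
Definition xmon (gamma : 'I_n -> nat) (S : {set 'I_n.+1}) : superO :=
  [ffun u : mono =>
     ([forall i, expo u i == gamma i] && (u.2 == S))%:R : F^o].

(* Linear extension of a map given on the basis monomials.                     *)
Definition lext_fun (f : mono -> superO) (a : superO) : superO :=
  \sum_(u : mono) coef a u *: f u.

Fact lext_fun_linear f : linear (lext_fun f).
Proof.
move=> k a b; rewrite /lext_fun scaler_sumr -big_split /=.
by apply: eq_bigr => u _; rewrite /coef !ffunE scalerDl scalerA.
Qed.

HB.instance Definition _ f :=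
  GRing.isLinear.Build F superO superO _ (lext_fun f) (lext_fun_linear f).

Definition lext (f : mono -> superO) : 'End(superO) := linfun (lext_fun f).

(* x_S x_T = (-1)^(inversions S T) x_(S :|: T) when S and T are disjoint.      *)
Definition inversions (S T : {set 'I_n.+1}) : nat :=
  #|[set st : 'I_n.+1 * 'I_n.+1 | [&& st.1 \in S, st.2 \in T & (st.2 < st.1)%N]]|.

Definition mono_mul (u v : mono) : superO :=
  if [disjoint u.2 & v.2] then
    ((-1) ^+ inversions u.2 v.2 *
       (\prod_(i < n) 'C(expo u i + expo v i, expo u i))%N%:R)
      *: xmon (fun i => expo u i + expo v i)%N (u.2 :|: v.2)
  else 0.

(* lmulO a b is the product a b in O.                                          *)
Definition lmulO (a : superO) : 'End(superO) :=
  \sum_(u : mono) coef a u *: lext (mono_mul u).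

(* parproj e is the projection of O onto its component of parity e, and        *)
(* psign k is the linear extension of a |-> (-1)^(k p(a)) a.                   *)
Definition parity (u : mono) : bool := odd #|u.2|.

Definition parproj (e : bool) : 'End(superO) :=
  lext (fun u => if parity u == e then xmon (expo u) u.2 else 0).

Definition psign (k : bool) : 'End(superO) :=
  parproj false + (-1) ^+ k *: parproj true.

(* The variables: inl i is x_(i+1) and inr j is x_(n+1+j), counted from 0 in   *)
(* 'I_n and 'I_n.+1.  The odd derivation carries the sign needed to bring the  *)
(* odd variable to the front of x_S.                                           *)
Definition partial (r : 'I_n + 'I_n.+1) : 'End(superO) :=
  match r with
  | inl i => lext (fun u => if expo u i == 0%N then 0
                            else xmon (fun j => expo u j - (j == i))%N u.2)
  | inr s => lext (fun u => if s \in u.2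
                            then (-1) ^+ #|[set j in u.2 | (j < s)%N]|
                                   *: xmon (expo u) (u.2 :\ s)
                            else 0)
  end.

Definition xvar (r : 'I_n + 'I_n.+1) : superO :=
  match r with
  | inl i => xmon (fun j => j == i) set0
  | inr s => xmon (fun=> 0%N) [set s]
  end.

(* The indices 1, ..., 2n: inl i stands for i+1 and inr i for n+i+1; plast     *)
(* is the remaining index 2n+1.                                                *)
Definition var (i : 'I_n + 'I_n) : 'I_n + 'I_n.+1 :=
  match i with
  | inl j => inl j
  | inr j => inr (widen_ord (leqnSn n) j)
  end.

Definition prime (i : 'I_n + 'I_n) : 'I_n + 'I_n :=
  match i with inl j => inr j | inr j => inl j end.

Definition mu (i : 'I_n + 'I_n) : bool := if i is inr _ then true else false.

Definition plast : 'I_n + 'I_n.+1 := inr ord_max.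

Definition euler : 'End(superO) :=
  \sum_(i : 'I_n + 'I_n) (lmulO (xvar (var i)) \o partial (var i))%VF.

Definition Delta : 'End(superO) :=
  \sum_(i < n) (partial (var (inl i)) \o partial (var (prime (inl i))))%VF.

Definition TH (a : superO) : 'End(superO) :=
  \sum_(i : 'I_n + 'I_n)
     (lmulO (partial (var (prime i)) (psign (mu (prime i)) a))
        \o partial (var i))%VF.

Definition DKO_fun (a : superO) : 'End(superO) :=
  TH a + (lmulO (partial plast (psign true a)) \o euler)%VF
    + (lmulO (euler a - 2%:R *: a) \o partial plast)%VF.

Fact lmulO_linear : linear lmulO.
Proof.
move=> k a b; rewrite /lmulO scaler_sumr -big_split /=.
by apply: eq_bigr => u _; rewrite /coef !ffunE scalerDl scalerA.
Qed.

HB.instance Definition _ :=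
  GRing.isLinear.Build F superO 'End(superO) _ lmulO lmulO_linear.

Fact DKO_fun_linear : linear DKO_fun.
Proof.
move=> k a b; rewrite /DKO_fun /TH.
under eq_bigr => i _ do rewrite !linearP /= comp_lfunDl -comp_lfunZl.
rewrite big_split /= -scaler_sumr !linearP /= !comp_lfunDl -!comp_lfunZl.
have -> : k *: euler a + euler b + (k *: - (2%:R *: a) - 2%:R *: b) =
  k *: (euler a - 2%:R *: a) + (euler b - 2%:R *: b).
  by rewrite scalerDr addrACA.
rewrite linearP /= comp_lfunDl -comp_lfunZl !scalerDr.
by rewrite (addrACA (k *: _)) (addrACA (k *: _ + _)).
Qed.

HB.instance Definition _ :=
  GRing.isLinear.Build F superO 'End(superO) _ DKO_fun DKO_fun_linear.

Definition DKO : 'Hom(superO, 'End(superO)) := linfun DKO_fun.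

Definition divl (lambda : F) : 'End(superO) :=
  2%:R *: ((Delta + ((euler - (n%:R * lambda) *: \1) \o partial plast))
             \o psign true)%VF.

(* homog e X is the component of parity e of the endomorphism X, and sbr is    *)
(* the bilinear extension of [X, Y] = X Y - (-1)^(p(X) p(Y)) Y X.              *)
Definition homog (e : bool) (X : 'End(superO)) : 'End(superO) :=
  \sum_(d : bool) (parproj (d (+) e) \o X \o parproj d)%VF.

Definition sbr (X Y : 'End(superO)) : 'End(superO) :=
  \sum_(d : bool) \sum_(e : bool)
     ((homog d X \o homog e Y)
        - (-1) ^+ (d && e) *: (homog e Y \o homog d X))%VF.

(* The span of the brackets [X, Y], X \in U, Y \in V (see brspaceP below).     *)
Definition brspace (U V : {vspace 'End(superO)}) : {vspace 'End(superO)} :=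
  <<allpairs sbr (vbasis U) (vbasis V)>>%VS.

Definition SKO2 (lambda : F) : {vspace 'End(superO)} :=
  (DKO @: lker (divl lambda))%VS.

Definition SKO1 (lambda : F) : {vspace 'End(superO)} :=
  brspace (SKO2 lambda) (SKO2 lambda).

Definition SKO (lambda : F) : {vspace 'End(superO)} :=
  brspace (SKO1 lambda) (SKO1 lambda).

Lemma DKOE a : DKO a = DKO_fun a.
Proof. exact: lfunE. Qed.

Lemma SKO2P lambda X :
  reflect (exists2 a, divl lambda a = 0 & X = DKO_fun a) (X \in SKO2 lambda).
Proof.
apply: (iffP memv_imgP) => [[a ka ->]|[a ka ->]]; exists a.
- by apply/eqP; rewrite -memv_ker.
- exact: DKOE.
- by rewrite memv_ker ka.
- by rewrite DKOE.
Qed.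

Fact homog_linear e : linear (homog e).
Proof.
move=> k X Y; rewrite /homog scaler_sumr -big_split /=.
apply: eq_bigr => d _.
by rewrite comp_lfunDr comp_lfunDl -comp_lfunZr -comp_lfunZl.
Qed.

HB.instance Definition _ e :=
  GRing.isLinear.Build F 'End(superO) 'End(superO) _ (homog e)
    (homog_linear e).

Fact sbr_linearl Y : linear (sbr^~ Y).
Proof.
move=> k X X'; rewrite /sbr scaler_sumr -big_split /=.
apply: eq_bigr => d _; rewrite scaler_sumr -big_split /=.
apply: eq_bigr => e _; rewrite linearP /= comp_lfunDl comp_lfunDr.
rewrite -comp_lfunZl -comp_lfunZr !scalerDr scalerN opprD addrACA.
by rewrite !scalerA [_ * k]mulrC.
Qed.

Fact sbr_linearr X : linear (sbr X).
Proof.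
move=> k Y Y'; rewrite /sbr scaler_sumr -big_split /=.
apply: eq_bigr => d _; rewrite scaler_sumr -big_split /=.
apply: eq_bigr => e _; rewrite linearP /= comp_lfunDl comp_lfunDr.
rewrite -comp_lfunZl -comp_lfunZr !scalerDr scalerN opprD addrACA.
by rewrite !scalerA [_ * k]mulrC.
Qed.

HB.instance Definition _ X :=
  GRing.isLinear.Build F 'End(superO) 'End(superO) _ (sbr X) (sbr_linearr X).

Lemma mem_brspace (U V : {vspace 'End(superO)}) X Y :
  X \in U -> Y \in V -> sbr X Y \in brspace U V.
Proof.
pose sbrl Z : {linear 'End(superO) -> 'End(superO)} :=
  HB.pack (sbr^~ Z) (GRing.isLinear.Build F _ _ _ (sbr^~ Z) (sbr_linearl Z)).
move=> /coord_vbasis-> /coord_vbasis->.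
rewrite linear_sum; apply: memv_suml => j _; rewrite linearZ /=; apply: memvZ.
rewrite -[sbr _ _]/(sbrl _ _) linear_sum.
apply: memv_suml => i _; rewrite linearZ; apply: memvZ; apply: memv_span.
by apply: allpairs_f; apply: mem_nth; rewrite size_tuple.
Qed.

Lemma brspaceP (U V W : {vspace 'End(superO)}) :
  reflect (forall X Y, X \in U -> Y \in V -> sbr X Y \in W)
          (brspace U V <= W)%VS.
Proof.
apply: (iffP idP) => [/subvP sW X Y UX VY|sW]; first exact/sW/mem_brspace.
apply/span_subvP => _ /allpairsP[[X Y] /= [UX VY ->]].
by apply: sW; apply: vbasis_mem.
Qed.

Definition incr_tuples (l : nat) : {set l.-tuple 'I_n} :=
  [set s : l.-tuple 'I_n | sorted ltn [seq val i | i <- s]].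

Definition S2set (lambda : F) : {set 'I_n.+1} :=
  [set k : 'I_n.+1 | n%:R * lambda - n%:R + (2 * k)%N%:R + 2%:R == 0].

Definition delta' (lambda : F) : nat := (n%:R * lambda + 1 == 0).

End Superalgebra.

(* Main.v *)
From HB Require Import structures.
Require Import Defs.
From mathcomp Require Import all_boot all_order all_algebra.
From mathcomp Require Import zify ring.

Set Implicit Arguments.
Unset Strict Implicit.
Unset Printing Implicit Defensive.

Import GRing.Theory.
Local Open Scope ring_scope.

(* Put c = n lambda and lap c = Delta + (D - c) d_(2n+1).  Up to parity signs,
   div_lambda is twice lap c, and D_KO(a) measures the failure of lap c to
   commute with the multiplication by a, as in a Batalin-Vilkovisky algebra.
   As lap c o lap (c + 2) = 0, for a and b in the kernel of lap c the bracket
   of D_KO(a) and D_KO(b) is D_KO(lap (c + 2) (+/- a b)).  Hence g' is inside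
   the image W of lap (c + 2) (under D_KO), and W is conversely spanned by the
   brackets of its elements, unless c = -1: then lap (c + 2) is the formal
   adjoint of lap c for the Berezin integral, so that only the image of the
   functions of integral 0 is reached; this is the term delta'. As for the
   rank of lap (c + 2), Delta is a de Rham differential, whose cohomology is
   spanned by 2^n monomials; D - c - 2 acts on those of type k by the scalar n
   - 2 k - 2 - c, which vanishes exactly for k in S_2. *)

(** * Signs of reorderings *)

(** The right-hand side of the theorem collapses: the sums over increasing tuples are elementary
    symmetric functions of the heights, and the formula equals half of dim O, that is 2^n times the
    product of the p^(t_j), minus the binomial sum and delta'. The half appears because the homotopy
    for Delta pairs off the monomials that are not cohomology classes, while of the 2^(n+1) class
    monomials only those containing x_(2n+1) can contribute. The algebra g' is never computed: a
    subspace W' of g'' that contains g and satisfies W' = [W', W'] lies in g', hence in g. To see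
    that W' is perfect, brackets are transported to potentials: bracketing lap (c + 2) z with a
    suitable a replaces z by a multiple of D_KO(a)(z) plus a multiple of z. With a of degree at most
    2 this reaches every monomial but the top one, which is no derivative; on it x_(2n+1) + c x_i
    x_(i') acts by 2 (c + 1). For c = -1 exactly one dimension is lost, because the kernel of lap (c
    + 2) then consists of functions of integral 0. *)

Lemma sum_setU_disjoint (I : finType) (A B : {set I}) (f : I -> nat) :
  [disjoint A & B] ->
  (\sum_(i in A :|: B) f i = \sum_(i in A) f i + \sum_(i in B) f i)%N.
Proof. by move=> dAB; rewrite -bigU //; apply: eq_bigl => i; rewrite !inE. Qed.

Section Inversions.

Variable n : nat.
Implicit Types S T U : {set 'I_n.+1}.

Lemma inversionsE S T :
  inversions S T = (\sum_(s in S) \sum_(x in T) (x < s))%N.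
Proof.
rewrite /inversions -sum1dep_card pair_big_dep /= big_mkcond [RHS]big_mkcond /=.
by apply: eq_bigr => -[s x] _ /=; do 2!case: (_ \in _) => //=; case: (_ < _)%N.
Qed.

Lemma inversionsUl S T U :
  [disjoint S & T] ->
  inversions (S :|: T) U = (inversions S U + inversions T U)%N.
Proof. by move=> dST; rewrite !inversionsE sum_setU_disjoint. Qed.

Lemma inversionsUr S T U :
  [disjoint T & U] ->
  inversions S (T :|: U) = (inversions S T + inversions S U)%N.
Proof.
move=> dTU; rewrite !inversionsE -big_split /=.
by apply: eq_bigr => s _; rewrite sum_setU_disjoint.
Qed.

Lemma inversionsC S T :
  [disjoint S & T] -> (inversions S T + inversions T S = #|S| * #|T|)%N.
Proof.
move=> dST; rewrite !inversionsE [X in (_ + X)%N]exchange_big /= -big_split /=.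
rewrite -sum_nat_const; apply: eq_bigr => s sS.
rewrite -big_split -sum1_card /=; apply: eq_bigr => x xT.
have: x != s by apply: contraTneq xT => ->; rewrite (disjointFr dST).
by rewrite -val_eqE /=; case: ltngtP.
Qed.

End Inversions.

(** * The product and the derivations of O *)

Lemma dvdn_bin_prime_power (p m k : nat) :
  prime p -> (0 < k < p ^ m)%N -> (p %| 'C(p ^ m, k))%N.
Proof.
case: k => // k p_pr /= ltk; apply: contraLR ltk => ndvd; rewrite -leqNgt.
have pm_gt0 : (0 < p ^ m)%N by rewrite expn_gt0 prime_gt0.
apply: dvdn_leq => //.
(* A binomial prime to p would make p^m divide k + 1, through (k + 1) C(p^m, k + 1) = p^m C(p^m - 1,
   k). *)
have cop : coprime (p ^ m) 'C(p ^ m, k.+1).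
  by rewrite coprimeXl // prime_coprime.
rewrite -(Gauss_dvdl _ cop).
by rewrite -{2}(prednK pm_gt0) -mul_bin_diag prednK // dvdn_mulr.
Qed.

Lemma lfunBE (K : fieldType) (V W : vectType K) (f g : 'Hom(V, W)) x :
  (f - g) x = f x - g x.
Proof. by rewrite add_lfunE opp_lfunE. Qed.

Definition lfE := (add_lfunE, lfunBE, opp_lfunE, scale_lfunE, comp_lfunE,
  id_lfunE, zero_lfunE).

Section Basis.

Variables (F : fieldType) (p n : nat) (t : 'I_n -> nat).

Notation O := (superO F p t).
Notation mono := (mono p t).
Notation xmon := (@xmon F p n t).
Notation height := (height p t).
Implicit Types (u v : mono) (g h : 'I_n -> nat) (S T : {set 'I_n.+1}).

Definition bas u : O := xmon (expo u) u.2.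

Lemma ocoefP (a b : O) : (forall u, coef a u = coef b u) -> a = b.
Proof. by move=> ab; apply/ffunP. Qed.

Lemma ocoefD (a b : O) u : coef (a + b) u = coef a u + coef b u.
Proof. by rewrite /coef ffunE. Qed.
Lemma ocoefN (a : O) u : coef (- a) u = - coef a u.
Proof. by rewrite /coef ffunE. Qed.
Lemma ocoefZ k (a : O) u : coef (k *: a) u = k * coef a u.
Proof. by rewrite /coef ffunE. Qed.
Lemma ocoef0 u : coef (0 : O) u = 0.
Proof. by rewrite /coef ffunE. Qed.
Lemma ocoefB (a b : O) u : coef (a - b) u = coef a u - coef b u.
Proof. by rewrite ocoefD ocoefN. Qed.
Lemma ocoef_sum I (r : seq I) P (f : I -> O) u :
  coef (\sum_(i <- r | P i) f i) u = \sum_(i <- r | P i) coef (f i) u.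
Proof.
by apply: (big_morph (fun a : O => coef a u)) => [a b|];
  rewrite ?ocoefD ?ocoef0.
Qed.

Lemma coef_xmon g S u :
  coef (xmon g S) u = ([forall i, expo u i == g i] && (u.2 == S))%:R.
Proof. by rewrite /coef ffunE. Qed.

Lemma eq_mono u v : expo u =1 expo v -> u.2 = v.2 -> u = v.
Proof.
case: u v => [u1 u2] [v1 v2] /= e ->; congr pair; apply/ffunP => i.
by apply: val_inj; apply: e.
Qed.

Lemma coef_bas u v : coef (bas u) v = (v == u)%:R.
Proof.
rewrite coef_xmon; congr (_%:R : F); congr nat_of_bool.
apply/andP/eqP => [[/forallP e /eqP]|->].
  by apply: eq_mono => i; apply/eqP.
by split=> //; apply/forallP.
Qed.

Lemma eq_xmon g h S : g =1 h -> xmon g S = xmon h S.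
Proof.
move=> e; apply: ocoefP => u; rewrite !coef_xmon; congr ((_ && _)%:R).
by apply: eq_forallb => i; rewrite e.
Qed.

Lemma expo_le u i : (expo u i <= height i)%N.
Proof. by rewrite -ltnS ltn_ord. Qed.

Lemma xmon_overflow g S i : (height i < g i)%N -> xmon g S = 0.
Proof.
move=> lt_i; apply: ocoefP => u; rewrite coef_xmon ocoef0.
case: forallP => //= /(_ i) /eqP e.
by move: (expo_le u i); rewrite e leqNgt lt_i.
Qed.

(** [inord] turns an exponent above the height into 0, so this is the intended monomial only under
    the bound assumed in [expo_mkmono]. *)
Definition mkmono g S : mono :=
  (finfun (fun i => inord (g i) : 'I_(height i).+1), S).

Lemma expo_mkmono g S i : (g i <= height i)%N -> expo (mkmono g S) i = g i.
Proof. by move=> le; rewrite /expo ffunE /= inordK. Qed.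

Lemma bas_mkmono g S : (forall i, (g i <= height i)%N) ->
  bas (mkmono g S) = xmon g S.
Proof. by move=> le; apply: eq_xmon => i; rewrite expo_mkmono. Qed.

(** As [xmon] overflows to 0, identities about it split into a basis vector case and a zero case;
    this view performs the split. *)
Variant xmon_spec g S : O -> Type :=
  | XmonBas u of expo u =1 g & u.2 = S : xmon_spec g S (bas u)
  | XmonOver i of (height i < g i)%N : xmon_spec g S 0.

Lemma xmonP g S : xmon_spec g S (xmon g S).
Proof.
case: (pickP (fun i => (height i < g i)%N)) => [i lt_i | le_g].
  by rewrite (xmon_overflow _ lt_i); apply: XmonOver lt_i.
have {}le_g i : (g i <= height i)%N by rewrite leqNgt le_g.
by rewrite -bas_mkmono //; constructor=> // i; rewrite expo_mkmono.
Qed.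

Lemma basis_sum (a : O) : a = \sum_u coef a u *: bas u.
Proof.
apply: ocoefP => v; rewrite ocoef_sum (bigD1 v) //= ocoefZ coef_bas eqxx mulr1.
rewrite big1 ?addr0 // => u /negPf ne.
by rewrite ocoefZ coef_bas eq_sym ne mulr0.
Qed.

Lemma eq_on_basis (V : lmodType F) (f g : {linear O -> V}) :
  (forall u, f (bas u) = g (bas u)) -> f =1 g.
Proof.
move=> e a; rewrite (basis_sum a) !linear_sum.
by apply: eq_bigr => u _; rewrite !linearZ /= e.
Qed.

Lemma eq_lfun_basis (V : vectType F) (f g : 'Hom(O, V)) :
  (forall u, f (bas u) = g (bas u)) -> f = g.
Proof. by move=> e; apply/lfunP; apply: eq_on_basis. Qed.

Lemma lextE (f : mono -> O) a : lext f a = \sum_u coef a u *: f u.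
Proof. by rewrite lfunE. Qed.

Lemma lext_bas (f : mono -> O) u : lext f (bas u) = f u.
Proof.
rewrite lextE (bigD1 u) //= coef_bas eqxx scale1r big1 ?addr0 // => v /negPf ne.
by rewrite coef_bas ne scale0r.
Qed.

End Basis.

(** * The associative product *)

Section Product.

Local Notation "a ** b" := (lmulO a b) (at level 40, left associativity).

Variables (F : fieldType) (p n : nat) (t : 'I_n -> nat).

Notation O := (superO F p t).
Notation mono := (mono p t).
Notation xmon := (@xmon F p n t).
Notation height := (height p t).
Notation bas := (@bas F p n t).
Implicit Types (u v : mono) (g h : 'I_n -> nat) (S T : {set 'I_n.+1}).
Implicit Types (a b c : O).

Fact mulr_linear b : linear (fun a => a ** b).
Proof. by move=> k a a'; rewrite linearP /= !lfE. Qed.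

(** Right multiplication as an endomorphism, so that an identity can be tested on the basis in its
    left factor as well. *)
Definition rmulO b : 'End(O) :=
  linfun (HB.pack_for {linear O -> O} (fun a => a ** b)
    (GRing.isLinear.Build F O O _ _ (mulr_linear b))).

Lemma rmulOE b a : rmulO b a = a ** b.
Proof. by rewrite lfunE. Qed.

Lemma smulDl a b c : (a + b) ** c = a ** c + b ** c.
Proof. by rewrite linearD /= lfE. Qed.
Lemma smulDr a b c : a ** (b + c) = a ** b + a ** c.
Proof. exact: linearD. Qed.
Lemma smulNl a b : (- a) ** b = - (a ** b).
Proof. by rewrite linearN /= lfE. Qed.
Lemma smulZl k a b : (k *: a) ** b = k *: (a ** b).
Proof. by rewrite linearZ /= lfE. Qed.
Lemma smulZr k a b : a ** (k *: b) = k *: (a ** b).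
Proof. exact: linearZ. Qed.
Lemma smul0l b : 0 ** b = 0.
Proof. by rewrite linear0 lfE. Qed.
Lemma smul0r a : a ** 0 = 0.
Proof. exact: linear0. Qed.

Lemma smul_suml I (r : seq I) P (f : I -> O) b :
  (\sum_(i <- r | P i) f i) ** b = \sum_(i <- r | P i) f i ** b.
Proof. by rewrite linear_sum sum_lfunE. Qed.
Definition bincoef g h : F := (\prod_(i < n) 'C(g i + h i, g i))%N%:R.

Lemma mul_bas u v :
  bas u ** bas v = mono_mul F u v.
Proof.
rewrite /lmulO sum_lfunE (bigD1 u) //= lfE lext_bas coef_bas eqxx scale1r.
rewrite big1 ?addr0 // => w /negPf ne.
by rewrite lfE coef_bas ne scale0r.
Qed.

Lemma mul_xmon g h S T : xmon g S ** xmon h T =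
  if [disjoint S & T] then
    ((-1) ^+ inversions S T * bincoef g h) *:
      xmon (fun i => g i + h i)%N (S :|: T)
  else 0.
Proof.
case: (xmonP F p t g S) => [u eu <-|i lt_i]; last first.
  rewrite smul0l; case: ifP => // _; rewrite (xmon_overflow F _ (i := i))
    ?scaler0 //.
  exact: leq_trans lt_i (leq_addr _ _).
case: (xmonP F p t h T) => [v ev <-|i lt_i]; last first.
  rewrite smul0r; case: ifP => // _; rewrite (xmon_overflow F _ (i := i))
    ?scaler0 //.
  exact: leq_trans lt_i (leq_addl _ _).
rewrite mul_bas /mono_mul; case: ifP => // _; congr (_ * _ *: _).
  by congr (_%:R); apply: eq_bigr => i _; rewrite eu ev.
by apply: eq_xmon => i; rewrite eu ev.
Qed.

(** Both sides are the trinomial coefficient (x + y + z)! / (x! y! z!). *)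
Lemma bin_assoc (x y z : nat) :
  ('C(x + y, x) * 'C(x + y + z, x + y) =
   'C(y + z, y) * 'C(x + (y + z), x))%N.
Proof.
have h i j : ('C(i + j, i) * (i`! * j`!) = (i + j)`!)%N.
  by have := bin_fact (leq_addr j i); rewrite addKn.
apply/eqP; rewrite -(eqn_pmul2r (fact_gt0 x)) -(eqn_pmul2r (fact_gt0 y)).
rewrite -(eqn_pmul2r (fact_gt0 z)) -!mulnA.
have e1 := h x y; have e2 := h (x + y)%N z; have e3 := h y z.
have e4 := h x (y + z)%N.
apply/eqP; transitivity ((x + y + z)`!)%N.
  by rewrite -e2 -e1; lia.
by rewrite -addnA -e4 -e3; lia.
Qed.

Lemma bincoef_assoc g h k :
  bincoef g h * bincoef (fun i => g i + h i)%N k =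
  bincoef h k * bincoef g (fun i => h i + k i)%N.
Proof.
rewrite -!natrM -!big_split /=; congr (_%:R).
by apply: eq_bigr => i _; apply: bin_assoc.
Qed.

(** By trilinearity three monomials suffice. Both bracketings vanish unless the odd parts are
    pairwise disjoint; then the signs agree because inversions are additive over disjoint unions. *)
Lemma smulA a b c : (a ** b) ** c = a ** (b ** c).
Proof.
suff e : (rmulO c \o rmulO b)%VF = rmulO (b ** c).
  by have /lfunP/(_ a) := e; rewrite lfE !rmulOE.
apply: eq_lfun_basis => u; rewrite lfE !rmulOE.
suff e : (rmulO c \o lmulO (bas u))%VF = (lmulO (bas u) \o rmulO c)%VF.
  by have /lfunP/(_ b) := e; rewrite !lfE !rmulOE.
apply: eq_lfun_basis => v; rewrite !lfE !rmulOE.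
suff e : lmulO (bas u ** bas v) = (lmulO (bas u) \o lmulO (bas v))%VF.
  by have /lfunP/(_ c) := e; rewrite !lfE.
apply: eq_lfun_basis => w; rewrite !lfE !mul_xmon.
case: ifPn => duv; last first.
  case: ifPn => dvw; rewrite ?smul0l ?smul0r // smulZr mul_xmon.
  rewrite disjoints_subset setCU subsetI -!disjoints_subset (negPf duv).
  by rewrite scaler0.
rewrite smulZl mul_xmon; case: ifPn => [|dvw]; last first.
  case: ifPn => [d2|_]; last by rewrite smul0r scaler0.
  rewrite smulZr mul_xmon; case: ifPn => [d3|_]; last by rewrite !scaler0.
  case/negP: dvw; rewrite disjoint_sym disjoints_subset setCU subsetI.
  rewrite -!disjoints_subset ![[disjoint w.2 & _]]disjoint_sym d2 andbT.
  by move: d3; rewrite disjoints_subset setCU subsetI -!disjoints_subset =>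
    /andP[].
rewrite disjoint_sym disjoints_subset setCU subsetI -!disjoints_subset.
rewrite ![[disjoint w.2 & _]]disjoint_sym => /andP[duw dvw].
rewrite dvw smulZr mul_xmon disjoints_subset setCU subsetI -!disjoints_subset.
rewrite duv duw /= !scalerA inversionsUl // inversionsUr // -setUA.
rewrite (eq_xmon _ _ _ (h := fun i => expo u i + (expo v i + expo w i))%N);
  last by move=> i; rewrite addnA.
congr (_ *: _); rewrite mulrACA bincoef_assoc [RHS]mulrACA -!exprD.
by congr (_ ^+ _ * _); lia.
Qed.

End Product.

(** * Parity and supercommutativity *)

Section Parity.

Local Notation "a ** b" := (lmulO a b) (at level 40, left associativity).

Variables (F : fieldType) (p n : nat) (t : 'I_n -> nat).

Notation O := (superO F p t).
Notation mono := (mono p t).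
Notation xmon := (@xmon F p n t).
Notation height := (height p t).
Notation bas := (@bas F p n t).
Notation psign := (psign F p t).
Notation parproj := (parproj F p t).
Notation partial := (partial F p t).
Implicit Types (u v : mono) (g h : 'I_n -> nat) (S T : {set 'I_n.+1}).
Implicit Types (a b c : O) (d e k : bool).

Lemma parproj_bas e u : parproj e (bas u) = if parity u == e then bas u else 0.
Proof. exact: lext_bas. Qed.

Lemma psign_bas k u : psign k (bas u) = (-1) ^+ (k && parity u) *: bas u.
Proof.
rewrite !lfE !parproj_bas eqbF_neg eqb_id.
by case: (parity u); rewrite /= ?andbT ?andbF ?add0r ?scaler0 ?addr0 ?scale1r.
Qed.

Lemma psignE k a : psign k a = parproj false a + (-1) ^+ k *: parproj true a.
Proof. by rewrite !lfE. Qed.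

Lemma psign0 a : psign false a = a.
Proof.
have -> : psign false = \1%VF; last by rewrite id_lfunE.
by apply: eq_lfun_basis => u; rewrite psign_bas id_lfunE scale1r.
Qed.

Lemma psignK : involutive (psign true).
Proof.
move=> a; rewrite -[LHS](comp_lfunE _ _).
have -> : (psign true \o psign true)%VF = \1%VF; last by rewrite id_lfunE.
apply: eq_lfun_basis => u; rewrite comp_lfunE id_lfunE psign_bas linearZ /=
  psign_bas.
by rewrite scalerA -expr2 sqrr_sign scale1r.
Qed.

(** The zero vector has both parities, so homogeneity of an image never requires knowing that it is
    nonzero. *)
Definition has_parity d a := parproj d a = a.

Lemma parproj_id d a : has_parity d (parproj d a).
Proof.
suff /lfunP/(_ a) : (parproj d \o parproj d)%VF = parproj d by rewrite
  comp_lfunE.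
apply: eq_lfun_basis => u; rewrite comp_lfunE parproj_bas; case: eqP => [e|_].
  by rewrite parproj_bas e eqxx.
exact: linear0.
Qed.

Lemma parproj_sum a : a = parproj false a + parproj true a.
Proof. by have := psign0 a; rewrite psignE scale1r. Qed.

Lemma hom_parproj d e a : has_parity d a -> parproj e a = if d == e then a else
  0.
Proof.
move=> ha; case: eqP => [<- //|ne].
have e0 : a + parproj (~~ d) a = a.
  by move: ha (parproj_sum a); rewrite /has_parity; case: (d) => /= -> h;
    rewrite [RHS]h // addrC.
have -> : e = ~~ d by case: d e ne {ha e0} => -[].
by apply: (addrI a); rewrite addr0.
Qed.

Lemma hom_psign d k a : has_parity d a -> psign k a = (-1) ^+ (k && d) *: a.
Proof.
move=> ha; rewrite psignE !(hom_parproj _ ha).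
by case: d {ha} => /=; rewrite ?andbT ?andbF ?add0r ?scaler0 ?addr0 ?scale1r.
Qed.

Lemma hom0 d : has_parity d 0. Proof. exact: linear0. Qed.
Lemma homD d a b : has_parity d a -> has_parity d b -> has_parity d (a + b).
Proof. by rewrite /has_parity linearD /= => -> ->. Qed.
Lemma homZ d (x : F) a : has_parity d a -> has_parity d (x *: a).
Proof. by rewrite /has_parity linearZ /= => ->. Qed.
Lemma homB d a b : has_parity d a -> has_parity d b -> has_parity d (a - b).
Proof. by rewrite /has_parity linearB /= => -> ->. Qed.
Lemma hom_sum d I r (P : pred I) (f : I -> O) :
  (forall i, P i -> has_parity d (f i)) -> has_parity d (\sum_(i <- r | P i) f
    i).
Proof.
move=> h; rewrite /has_parity linear_sum; apply: eq_bigr => i Pi; exact: h.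
Qed.

Lemma hom_bas u : has_parity (parity u) (bas u).
Proof. by rewrite /has_parity parproj_bas eqxx. Qed.

Lemma hom_xmon g S : has_parity (odd #|S|) (xmon g S).
Proof. by case: xmonP => [u _ <-|*]; [apply: hom_bas | apply: hom0]. Qed.

Lemma hom_of_basis d (f : 'End(O)) :
  (forall u, has_parity (d (+) parity u) (f (bas u))) ->
  forall e a, has_parity e a -> has_parity (d (+) e) (f a).
Proof.
move=> hf e a <-; rewrite /has_parity.
suff /lfunP/(_ a) : (parproj (d (+) e) \o (f \o parproj e))%VF = (f \o parproj
  e)%VF.
  by rewrite !comp_lfunE.
apply: eq_lfun_basis => u; rewrite !comp_lfunE parproj_bas.
by case: eqP => [<-|_]; [apply: hf | rewrite !linear0].
Qed.

Lemma hom_mul d e a b : has_parity d a -> has_parity e b ->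
  has_parity (d (+) e) (a ** b).
Proof.
move=> ha hb; rewrite addbC -rmulOE; move: d a ha; apply: hom_of_basis => u.
rewrite rmulOE addbC; move: e b hb; apply: hom_of_basis => v.
rewrite mul_xmon; case: ifP => [duv|_]; last exact: hom0.
apply: homZ; rewrite /parity -oddD.
by have := hom_xmon (fun i => expo u i + expo v i)%N (u.2 :|: v.2);
  rewrite cardsU disjoint_setI0 // cards0 subn0.
Qed.

Lemma psignD k a b : psign k (a + b) = psign k a + psign k b.
Proof. exact: linearD. Qed.
Lemma psignZ k (x : F) a : psign k (x *: a) = x *: psign k a.
Proof. exact: linearZ. Qed.

Lemma psign_mul k a b : psign k (a ** b) = psign k a ** psign k b.
Proof.
case: k; last by rewrite !psign0.
have h d e a' b' : has_parity d a' -> has_parity e b' ->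
    psign true (a' ** b') = psign true a' ** psign true b'.
  move=> ha hb; rewrite [LHS](hom_psign true (hom_mul ha hb)).
  rewrite (hom_psign true ha) (hom_psign true hb) smulZl smulZr scalerA.
  by rewrite -exprD -[in RHS]signr_odd oddD !oddb.
have [-> ->] := (parproj_sum a, parproj_sum b).
have [ha0 ha1] := (parproj_id false a, parproj_id true a).
have [hb0 hb1] := (parproj_id false b, parproj_id true b).
move: (parproj _ a) (parproj _ a) (parproj _ b) (parproj _ b) ha0 ha1 hb0 hb1.
move=> a0 a1 b0 b1 ha0 ha1 hb0 hb1.
rewrite smulDl 2!smulDr 5!psignD smulDl 2!smulDr.
by rewrite (h _ _ _ _ ha0 hb0) (h _ _ _ _ ha0 hb1) (h _ _ _ _ ha1 hb0) (h _ _ _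
  _ ha1 hb1).
Qed.

(* Supercommutativity, stated so that only one factor is homogeneous. *)
Lemma hom_mulC d a b : has_parity d a -> a ** b = psign d b ** a.
Proof.
move=> <-; rewrite -rmulOE.
have /lfunP/(_ a) : (rmulO b \o parproj d)%VF = (lmulO (psign d b) \o parproj
  d)%VF;
  last by rewrite !comp_lfunE.
apply: eq_lfun_basis => u; rewrite !comp_lfunE parproj_bas.
case: eqP => [<- {d}|_]; last by rewrite !linear0.
rewrite rmulOE -rmulOE.
have /lfunP/(_ b) : lmulO (bas u) = (rmulO (bas u) \o psign (parity u))%VF;
  last by rewrite comp_lfunE rmulOE => <-; rewrite rmulOE.
apply: eq_lfun_basis => v; rewrite comp_lfunE rmulOE psign_bas smulZl !mul_xmon.
rewrite disjoint_sym; case: ifP => dvu; last by rewrite scaler0.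
rewrite setUC (eq_xmon _ _ _ (h := fun i => expo v i + expo u i)%N);
  last by move=> i; rewrite addnC.
rewrite scalerA mulrA; congr (_ * _ *: _).
  rewrite -exprD -signr_odd -[RHS]signr_odd oddD oddb.
  by rewrite /parity -oddM mulnC -(inversionsC dvu) oddD addbAC addbb.
congr (_%:R); apply: eq_bigr => i _.
by rewrite -[RHS]bin_sub ?leq_addr // addKn addnC.
Qed.

Definition unitO : O := xmon (fun=> 0%N) set0.

Lemma smul1l a : unitO ** a = a.
Proof.
have /lfunP/(_ a) : lmulO unitO = \1%VF; last by rewrite id_lfunE.
apply: eq_lfun_basis => u; rewrite id_lfunE mul_xmon disjoints_subset sub0set.
rewrite set0U (@eq_xmon _ _ _ _ _ (expo u)) // inversionsE big_set0 mul1r.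
by rewrite /bincoef big1 ?scale1r // => i _; rewrite bin0.
Qed.

Lemma hom_one : has_parity false unitO.
Proof. by have := hom_xmon (fun=> 0%N) set0; rewrite cards0. Qed.

Lemma smul1r a : a ** unitO = a.
Proof. by rewrite -{2}[a]smul1l (hom_mulC _ hom_one) psign0. Qed.

End Parity.

(** * The Leibniz rules *)

Section Derivations.

Local Notation "a ** b" := (lmulO a b) (at level 40, left associativity).

Variables (F : fieldType) (p n : nat) (t : 'I_n -> nat).

Notation O := (superO F p t).
Notation mono := (mono p t).
Notation xmon := (@xmon F p n t).
Notation height := (height p t).
Notation bas := (@bas F p n t).
Notation psign := (psign F p t).
Notation parproj := (parproj F p t).
Notation partial := (partial F p t).
Implicit Types (u v : mono) (g h : 'I_n -> nat) (S T : {set 'I_n.+1}).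
Implicit Types (a b c : O) (d e k : bool) (i j : 'I_n) (s : 'I_n.+1).

Lemma partial_xmon_even i g S : (g i <= height i)%N ->
  partial (inl i) (xmon g S) =
    if g i == 0%N then 0 else xmon (fun j => g j - (j == i))%N S.
Proof.
move=> le_i; case: xmonP => [u eu <-|j lt_j]; last first.
  rewrite linear0; case: eqP => // _; rewrite (xmon_overflow F _ (i := j)) //.
  have /negPf -> : j != i by apply: contraTneq lt_j => ->; rewrite -leqNgt.
  by rewrite subn0.
rewrite lext_bas eu; case: eqP => // _.
by apply: eq_xmon => j; rewrite eu.
Qed.

Lemma partial_xmon_odd s g S :
  partial (inr s) (xmon g S) =
    if s \in S then (-1) ^+ inversions [set s] (S :\ s) *: xmon g (S :\ s)
    else 0.
Proof.
case: xmonP => [u eu <-|j lt_j]; last first.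
  by rewrite linear0 (xmon_overflow F _ lt_j) scaler0 if_same.
rewrite lext_bas; case: ifP => // _; rewrite (eq_xmon F _ t _ eu).
congr (_ ^+ _ *: _); rewrite inversionsE big_set1 -sum1dep_card.
rewrite big_mkcond [RHS]big_mkcond /=; apply: eq_bigr => x _.
rewrite !inE; case: (ltngtP x s) => [lt|gt|/val_inj ->];
  last by rewrite eqxx andbF.
  by rewrite -val_eqE neq_ltn lt andbT.
by rewrite andbF; case: ifP.
Qed.

(** Parity enters through an explicit [m], so that the hypothesis is a linear equation between
    inversion numbers, within reach of [lia]. *)
Lemma sign_odd_cancel (k l m : nat) : (k + l = m.*2.+1)%N ->
  (-1) ^+ k + (-1) ^+ l = 0 :> F.
Proof.
move/(congr1 odd); rewrite /= odd_double oddD -(signr_odd _ k) -(signr_odd _ l).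
by case: (odd k) (odd l) => -[] //= _; rewrite ?subrr // addNr.
Qed.

Lemma eq_sign (k l m : nat) : (k + l = m.*2)%N -> (-1) ^+ k = (-1) ^+ l :> F.
Proof.
move/(congr1 odd); rewrite odd_double oddD -(signr_odd _ k) -(signr_odd _ l).
by case: (odd k) (odd l) => -[].
Qed.

Lemma bincoef_split i g h : bincoef F g h =
  'C(g i + h i, g i)%:R * (\prod_(j < n | j != i) 'C(g j + h j, g j))%N%:R.
Proof. by rewrite /bincoef (bigD1 i) //= natrM. Qed.

Lemma partial_odd_mul s a b :
  partial (inr s) (a ** b) =
    partial (inr s) a ** b + psign true a ** partial (inr s) b.
Proof.
rewrite -!rmulOE; set D := partial (inr s).
have /lfunP/(_ a) : ((D \o rmulO b) = (rmulO b \o D) + (rmulO (D b) \o psign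
  true))%VF;
  last by rewrite add_lfunE !comp_lfunE.
apply: eq_lfun_basis => u; rewrite add_lfunE !comp_lfunE !rmulOE.
have /lfunP/(_ b) : ((D \o lmulO (bas u)) = lmulO (D (bas u)) + (lmulO (psign
  true (bas u)) \o D))%VF;
  last by rewrite add_lfunE !comp_lfunE.
apply: eq_lfun_basis => v; rewrite add_lfunE !comp_lfunE psign_bas /=.
rewrite smulZl {}/D !partial_xmon_odd mul_xmon /parity signr_odd.
set S := u.2; set T := v.2.
rewrite (_ : (if s \in S then _ else 0) ** _ =
  (if (s \in S) && [disjoint S :\ s & T] then
     ((-1) ^+ (inversions [set s] (S :\ s) + inversions (S :\ s) T)
        * bincoef F (expo u) (expo v))
     *: xmon (fun i => expo u i + expo v i)%N (S :\ s :|: T) else 0));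
       last first.
  case: ifP => _; last by rewrite smul0l.
  by rewrite smulZl mul_xmon; case: ifP => _; rewrite ?scaler0 // scalerA mulrA
    exprD.
rewrite (_ : _ ** (if s \in T then _ else 0) =
  (if (s \in T) && [disjoint S & T :\ s] then
     ((-1) ^+ (inversions [set s] (T :\ s) + inversions S (T :\ s))
        * bincoef F (expo u) (expo v))
     *: xmon (fun i => expo u i + expo v i)%N (S :|: (T :\ s)) else 0));
       last first.
  case: ifP => _; last by rewrite smul0r.
  by rewrite smulZr mul_xmon; case: ifP => _; rewrite ?scaler0 // scalerA mulrA
    exprD.
have dis1 (A : {set 'I_n.+1}) : s \notin A -> [disjoint [set s] & A].
  by rewrite disjoints1.
have dis2 (A : {set 'I_n.+1}) : s \notin A -> [disjoint A & [set s]].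
  by rewrite disjoint_sym; apply: dis1.
have sD (A : {set 'I_n.+1}) : s \notin A :\ s by rewrite !inE eqxx.
have Ds (A : {set 'I_n.+1}) : s \notin A -> A :\ s = A.
  by move=> sA; apply/setDidPl; rewrite disjoint_sym disjoints1.
have ss : inversions [set s] [set s] = 0%N.
  by rewrite inversionsE !big_set1 ltnn.
have cardS (A : {set 'I_n.+1}) : s \notin A ->
    (inversions A [set s] + inversions [set s] A = #|A|)%N.
  by move=> sA; rewrite inversionsC ?cards1 ?muln1 // dis2.
(* If s lies in both S and T, the product is 0 and the two terms cancel; if it lies in just one,
   only the term differentiating that factor survives; otherwise all three vanish. *)
have [sS|sS] := boolP (s \in S); have [sT|sT] := boolP (s \in T) => /=.
- have -> : [disjoint S & T] = false.
    by apply/negbTE/pred0Pn; exists s; rewrite /= sS.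
  rewrite linear0; set dST := [disjoint S & T :\ s].
  have -> : [disjoint S :\ s & T] = dST.
    by rewrite /dST !disjoints_subset; apply/subsetP/subsetP => h x;
      have := h x; rewrite !inE; case: eqP => //= -> /(_ sS).
  case: ifP => [d|_]; last by rewrite scaler0 addr0.
  have -> : S :\ s :|: T = S :|: T :\ s.
    by apply/setP => x; rewrite !inE; case: eqP => // ->; rewrite sS sT.
  rewrite scalerA mulrA -exprD -scalerDl -mulrDl.
  have eS : [set s] :|: S :\ s = S by rewrite setD1K.
  have eT : [set s] :|: T :\ s = T by rewrite setD1K.
  have A1 := inversionsUr (S :\ s) (dis1 _ (sD T)); rewrite eT in A1.
  have A2 := inversionsUl (T :\ s) (dis1 _ (sD S)); rewrite eS in A2.
  have A3 := cardS _ (sD S); have A4 := cardsD1 s S; rewrite sS in A4.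
  rewrite (@sign_odd_cancel _ _ (inversions [set s] (S :\ s) + inversions (S :\
    s) [set s]
    + inversions [set s] (T :\ s) + inversions (S :\ s) (T :\ s))) ?mul0r
      ?scale0r //.
  by rewrite A1 A2 A4 -A3; lia.
- rewrite scaler0 addr0.
  have -> : [disjoint S & T] = [disjoint S :\ s & T].
    rewrite !disjoints_subset; apply/subsetP/subsetP => h x;
      have := h x; rewrite !inE; case: eqP => //= ->; by rewrite (negPf sT).
  case: ifP => d; last by rewrite linear0.
  rewrite linearZ /= partial_xmon_odd !inE sS /= scalerA.
  have -> : (S :|: T) :\ s = S :\ s :|: T.
    by apply/setP => x; rewrite !inE; case: eqP => //= ->; rewrite (negPf sT).
  congr (_ *: _); rewrite mulrAC -exprD; congr (_ * _).
  have eS : [set s] :|: S :\ s = S by rewrite setD1K.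
  have A1 := inversionsUl T (dis1 _ (sD S)); rewrite eS in A1.
  have A2 := inversionsUr [set s] d.
  apply: (@eq_sign _ _ (inversions [set s] T + inversions [set s] (S :\ s) +
    inversions (S :\ s) T)).
  by rewrite A1 A2; lia.
- rewrite add0r.
  have -> : [disjoint S & T] = [disjoint S & T :\ s].
    rewrite !disjoints_subset; apply/subsetP/subsetP => h x;
      have := h x; rewrite !inE; case: eqP => //= ->; by rewrite (negPf sS).
  case: ifP => d; last by rewrite linear0 scaler0.
  rewrite linearZ /= partial_xmon_odd !inE sT orbT /= !scalerA.
  have -> : (S :|: T) :\ s = S :|: T :\ s.
    by apply/setP => x; rewrite !inE; case: eqP => //= ->; rewrite (negPf sS).
  congr (_ *: _); rewrite mulrAC mulrA -!exprD; congr (_ * _).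
  have eT : [set s] :|: T :\ s = T by rewrite setD1K.
  have A1 := inversionsUr S (dis1 _ (sD T)); rewrite eT in A1.
  have A2 := inversionsUr [set s] d.
  have A3 := cardS _ sS.
  apply: (@eq_sign _ _ (inversions S [set s] + inversions S (T :\ s) +
    inversions [set s] S + inversions [set s] (T :\ s))).
  by rewrite A1 A2 -A3; lia.
- rewrite scaler0 addr0; case: ifP => d; last by rewrite linear0.
  by rewrite linearZ /= partial_xmon_odd !inE (negPf sS) (negPf sT) scaler0.
Qed.

Hypothesis p_char : p \in [pchar F].

(* When u_i + v_i exceeds the height by one, the product vanishes but the two  *)
(* terms of the Leibniz rule do not: they cancel as p divides the binomials of *)
(* p ^ t_i.                                                                    *)
Lemma partial_even_mul i a b :
  partial (inl i) (a ** b) = partial (inl i) a ** b + a ** partial (inl i) b.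
Proof.
have p_pr := pcharf_prime p_char.
rewrite -!rmulOE; set D := partial (inl i).
have /lfunP/(_ a) : ((D \o rmulO b) = (rmulO b \o D) + rmulO (D b))%VF;
  last by rewrite add_lfunE !comp_lfunE.
apply: eq_lfun_basis => u; rewrite add_lfunE !comp_lfunE !rmulOE.
have /lfunP/(_ b) : ((D \o lmulO (bas u)) = lmulO (D (bas u)) + (lmulO (bas u)
  \o D))%VF;
  last by rewrite add_lfunE !comp_lfunE.
apply: eq_lfun_basis => v; rewrite add_lfunE !comp_lfunE.
rewrite {}/D !partial_xmon_even ?expo_le // mul_xmon.
set x := expo u i; set y := expo v i.
have [duv|nd] := ifPn; last first.
  rewrite linear0; case: eqP => _; rewrite ?smul0l ?mul_xmon ?(negPf nd);
  by case: eqP => _; rewrite ?smul0r ?mul_xmon ?(negPf nd) ?addr0.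
pose Z := xmon (fun j => expo u j + expo v j - (j == i))%N (u.2 :|: v.2).
pose r : F := (\prod_(j < n | j != i) 'C(expo u j + expo v j, expo u j))%N%:R.
pose sg : F := (-1) ^+ inversions u.2 v.2.
have -> : (if x == 0%N then 0 else xmon (fun j =>
  expo u j - (j == i))%N u.2) ** bas v
   = (if x == 0%N then 0 else (sg * ('C(x.-1 + y, x.-1)%:R * r)) *: Z).
  case: eqP => [_|/eqP x0]; first by rewrite smul0l.
  rewrite mul_xmon duv (bincoef_split i) eqxx subn1 -/x -/y.
  rewrite -/sg; congr (_ * (_ * _) *: _).
    by congr (_%:R); apply: eq_bigr => j /negPf ->; rewrite subn0.
  apply: eq_xmon => j; case: eqP => [->|_]; last by rewrite !subn0.
  by rewrite -/x -/y; lia.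
have -> : bas u ** (if y == 0%N then 0 else xmon (fun j =>
  expo v j - (j == i))%N v.2)
   = (if y == 0%N then 0 else (sg * ('C(x + y.-1, x)%:R * r)) *: Z).
  case: eqP => [_|/eqP y0]; first by rewrite smul0r.
  rewrite mul_xmon duv (bincoef_split i) eqxx subn1 -/x -/y.
  rewrite -/sg; congr (_ * (_ * _) *: _).
    by congr (_%:R); apply: eq_bigr => j /negPf ->; rewrite subn0.
  apply: eq_xmon => j; case: eqP => [->|_]; last by rewrite !subn0.
  by rewrite -/x -/y; lia.
rewrite linearZ /= (bincoef_split i) -/x -/y -/r -/sg.
have [xy0|xy0] := posnP (x + y)%N.
  have [-> ->] : x = 0%N /\ y = 0%N by lia.
  rewrite eqxx addr0; apply/eqP; rewrite scaler_eq0; apply/orP; right.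
  by rewrite partial_xmon_even -/x -/y xy0.
have -> : (if x == 0%N then 0 else (sg * ('C(x.-1 + y, x.-1)%:R * r)) *: Z) +
    (if y == 0%N then 0 else (sg * ('C(x + y.-1, x)%:R * r)) *: Z) =
    (sg * ('C(x + y, x)%:R * r)) *: Z.
  move: xy0; case: (x) (y) => [|x'] [|y'] //= _.
  - by rewrite !add0n !bin0 add0r.
  - by rewrite !addn0 !binn addr0.
  - rewrite -scalerDl -mulrDr -mulrDl -natrD; congr (_ * (_%:R * _) *: _).
    by rewrite !addSn !addnS binS addnC.
have [le_h|gt_h] := leqP (x + y) (height i).
  by rewrite partial_xmon_even -/x -/y // (gtn_eqF xy0).
rewrite (xmon_overflow F _ (i := i)) // linear0 scaler0.
move: gt_h; rewrite leq_eqVlt => /predU1P[e|gt_h]; last first.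
  rewrite /Z (xmon_overflow F _ (i := i)) ?scaler0 //.
  by rewrite eqxx -/x -/y; lia.
have x_le : (x <= height i)%N := expo_le u i.
have y_le : (y <= height i)%N := expo_le v i.
have eh : (height i).+1 = (p ^ t i)%N.
  by rewrite prednK // expn_gt0 prime_gt0.
have : (p %| 'C(x + y, x))%N.
  by rewrite -e eh dvdn_bin_prime_power // -eh; lia.
by rewrite (dvdn_pcharf p_char) => /eqP ->; rewrite mul0r mulr0 scale0r.
Qed.

End Derivations.

#[global] Arguments partial : simpl never.
#[global] Arguments xvar : simpl never.
#[global] Arguments var : simpl never.

Ltac coef_ring :=
  apply: ocoefP => ?; rewrite !(ocoefD, ocoefB, ocoefN, ocoefZ, ocoef0); ring.

(** * Commutation relations of the derivations *)

Section Calculus.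

Local Notation "a ** b" := (lmulO a b) (at level 40, left associativity).

Variables (F : fieldType) (p n : nat) (t : 'I_n -> nat).
Notation O := (superO F p t).
Notation mono := (mono p t).
Notation xmon := (@xmon F p n t).
Notation height := (height p t).
Notation bas := (@bas F p n t).
Notation psign := (psign F p t).
Notation parproj := (parproj F p t).
Notation partial := (partial F p t).
Notation unitO := (unitO F p t).
Implicit Types (u v : mono) (g h : 'I_n -> nat) (S T : {set 'I_n.+1}).
Implicit Types (a b : O) (d e k : bool) (i j : 'I_n) (s r : 'I_n.+1).

Lemma dx_comm i j a :
  partial (inl i) (partial (inl j) a) = partial (inl j) (partial (inl i) a).
Proof.
have [->//|ne] := eqVneq i j.
have /lfunP/(_ a) : (partial (inl i) \o partial (inl j) = partial (inl j) \o
  partial (inl i))%VF;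
  last by rewrite !comp_lfunE.
apply: eq_lfun_basis => u; rewrite !comp_lfunE !partial_xmon_even ?expo_le //.
case: eqP => [uj|uj]; case: eqP => [ui|ui]; rewrite ?linear0 //.
- by rewrite partial_xmon_even ?(leq_trans (leq_subr _ _)) ?expo_le // uj.
- by rewrite partial_xmon_even ?(leq_trans (leq_subr _ _)) ?expo_le // ui.
rewrite !partial_xmon_even ?(leq_trans (leq_subr _ _)) ?expo_le //.
have ne' : j != i by rewrite eq_sym.
rewrite (negPf ne) (negPf ne') !subn0.
move/eqP/negPf: ui => ->; move/eqP/negPf: uj => ->.
by apply: eq_xmon => k; rewrite subnAC.
Qed.

Lemma dx_dxi_comm i s a :
  partial (inl i) (partial (inr s) a) = partial (inr s) (partial (inl i) a).
Proof.
have /lfunP/(_ a) : (partial (inl i) \o partial (inr s) = partial (inr s) \o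
  partial (inl i))%VF;
  last by rewrite !comp_lfunE.
apply: eq_lfun_basis => u; rewrite !comp_lfunE.
rewrite partial_xmon_even ?expo_le // partial_xmon_odd.
case: ifP => us; case: eqP => ui; rewrite ?linear0 // ?linearZ /=
  ?partial_xmon_even ?expo_le //.
- by rewrite ui scaler0.
- by rewrite partial_xmon_odd us; move/eqP/negPf: ui => ->.
by rewrite partial_xmon_odd us.
Qed.

Lemma dxi_anti s r a :
  partial (inr s) (partial (inr r) a) = - partial (inr r) (partial (inr s) a).
Proof.
have /lfunP/(_ a) : (partial (inr s) \o partial (inr r) = - (partial (inr r) \o
  partial (inr s)))%VF;
  last by rewrite opp_lfunE !comp_lfunE.
apply: eq_lfun_basis => u; rewrite opp_lfunE !comp_lfunE !partial_xmon_odd.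
case us: (s \in u.2); case ur: (r \in u.2); rewrite ?linear0 ?oppr0 ?linearZ
  //= ?partial_xmon_odd.
- have [->|ne] := eqVneq s r; first by rewrite !inE eqxx oppr0.
  rewrite !inE us ur [r == s]eq_sym ne /= scalerN !scalerA -scaleNr -!exprD.
  have -> : u.2 :\ s :\ r = u.2 :\ r :\ s by rewrite !setDDl setUC.
  congr (_ *: _); apply/eqP; rewrite -addr_eq0; apply/eqP.
  set W := u.2 :\ r :\ s.
  have e1 : [set s] :|: W = u.2 :\ r by rewrite setD1K // !inE us ne.
  have e2 : [set r] :|: W = u.2 :\ s.
    by apply/setP => x; rewrite !inE; case: (eqVneq x r) => //= ->;
      rewrite eq_sym ne ur.
  rewrite -e1 -e2 !inversionsUr ?disjoints1 ?inE ?eqxx ?andbF //.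
  have e3 : (inversions [set r] [set s] + inversions [set s] [set r] = 1)%N.
    by rewrite inversionsC ?cards1 // disjoints1 inE eq_sym.
  apply: (@sign_odd_cancel _ _ _ (inversions [set r] W + inversions [set s] W)).
  by move: e3; lia.
- by rewrite !inE ur andbF oppr0 scaler0.
- by rewrite !inE us andbF scaler0.
Qed.

Hypothesis p_char : p \in [pchar F].
Hypothesis p_gt2 : (2 < p)%N.
Hypothesis t_gt0 : forall i, (0 < t i)%N.

Lemma two_neq0 : 2%:R != 0 :> F.
Proof. by rewrite -(dvdn_pcharf p_char) gtnNdvd. Qed.

Lemma height_gt0 i : (0 < height i)%N.
Proof.
rewrite /Defs.height -subn1 subn_gt0 -(exp1n (t i)) ltn_exp2r //.
by rewrite (ltn_trans _ p_gt2).
Qed.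

Lemma dxi_sq s a : partial (inr s) (partial (inr s) a) = 0.
Proof.
have /eqP := dxi_anti s s a; rewrite -addr_eq0 -mulr2n -scaler_nat scaler_eq0.
by rewrite (negPf two_neq0) => /eqP.
Qed.

Lemma psign_dx k i a : psign k (partial (inl i) a) = partial (inl i) (psign k
  a).
Proof.
have /lfunP/(_ a) : (psign k \o partial (inl i) = partial (inl i) \o psign
  k)%VF;
  last by rewrite !comp_lfunE.
apply: eq_lfun_basis => u; rewrite !comp_lfunE psign_bas linearZ /=.
rewrite partial_xmon_even ?expo_le //; case: eqP => _;
  first by rewrite linear0 scaler0.
by rewrite (hom_psign _ (hom_xmon _ _ _ _ _)).
Qed.

Lemma psign_dxi s a : psign true (partial (inr s) a) = - partial (inr s) (psign
  true a).
Proof.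
have /lfunP/(_ a) : (psign true \o partial (inr s) = - (partial (inr s) \o
  psign true))%VF;
  last by rewrite opp_lfunE !comp_lfunE.
apply: eq_lfun_basis => u; rewrite opp_lfunE !comp_lfunE psign_bas linearZ /=.
rewrite partial_xmon_odd; case: ifP => su; last by rewrite linear0 scaler0
  oppr0.
rewrite psignZ (hom_psign _ (hom_xmon _ _ _ _ _)) /= !scalerA -scaleNr mulrC.
by rewrite /parity (cardsD1 s u.2) su /= add0n signrN mulNr opprK.
Qed.

Lemma hom_dx i d a : has_parity d a -> has_parity d (partial (inl i) a).
Proof.
apply: (@hom_of_basis _ _ _ _ false) => u /=.
rewrite partial_xmon_even ?expo_le //; case: eqP => _; first exact: hom0.
by apply: hom_xmon.
Qed.

Lemma hom_dxi s d a : has_parity d a -> has_parity (~~ d) (partial (inr s) a).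
Proof.
apply: (@hom_of_basis _ _ _ _ true) => u /=.
rewrite partial_xmon_odd; case: ifP => su; last exact: hom0.
apply: homZ; have := hom_xmon F p t (expo u) (u.2 :\ s).
by rewrite /parity (cardsD1 s u.2) su /= negbK.
Qed.

Lemma partial_one (r : 'I_n + 'I_n.+1) : partial r unitO = 0.
Proof.
case: r => [i|s]; first by rewrite partial_xmon_even.
by rewrite partial_xmon_odd inE.
Qed.

Lemma dx_xvar i j : partial (inl i) (xvar F p t (inl j)) = (i == j)%:R *: unitO.
Proof.
rewrite partial_xmon_even; last by case: eqP => // _; apply: height_gt0.
have [->|ne] := eqVneq i j; last by rewrite scale0r.
by rewrite scale1r; apply: eq_xmon => k; rewrite subnn.
Qed.

Lemma dx_xvar_odd i s : partial (inl i) (xvar F p t (inr s)) = 0.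
Proof. by rewrite partial_xmon_even. Qed.

Lemma dxi_xvar_even s i : partial (inr s) (xvar F p t (inl i)) = 0.
Proof. by rewrite partial_xmon_odd inE. Qed.

Lemma dxi_xvar s r : partial (inr s) (xvar F p t (inr r)) = (s == r)%:R *:
  unitO.
Proof.
rewrite partial_xmon_odd inE; case: eqP => [->|_]; last by rewrite scale0r.
by rewrite setDv inversionsE big_set1 big_set0.
Qed.

Lemma hom_xvar_even i : has_parity false (xvar F p t (inl i)).
Proof. by have := hom_xmon F p t (fun j => j == i) set0; rewrite cards0. Qed.

Lemma hom_xvar_odd s : has_parity true (xvar F p t (inr s)).
Proof. by have := hom_xmon F p t (fun=> 0%N) [set s]; rewrite cards1. Qed.

End Calculus.

Definition oddvar n (i : 'I_n) : 'I_n + 'I_n.+1 := inr (widen_ord (leqnSn n) i).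

(** * Second order operators *)

(* The operations are locked, so that rewriting never unfolds them into their  *)
(* matrix representation.                                                      *)
HB.lock Definition smul (F : fieldType) (p n : nat) (t : 'I_n -> nat)
  (a b : superO F p t) : superO F p t := lmulO a b.
HB.lock Definition pd (F : fieldType) (p n : nat) (t : 'I_n -> nat)
  (r : 'I_n + 'I_n.+1) (a : superO F p t) : superO F p t := partial F p t r a.
HB.lock Definition sgn (F : fieldType) (p n : nat) (t : 'I_n -> nat)
  (a : superO F p t) : superO F p t := psign F p t true a.
HB.lock Definition xv (F : fieldType) (p n : nat) (t : 'I_n -> nat)
  (r : 'I_n + 'I_n.+1) : superO F p t := xvar F p t r.
HB.lock Definition eul (F : fieldType) (p n : nat) (t : 'I_n -> nat)
  (a : superO F p t) : superO F p t :=
  \sum_i (smul (xv F p t (inl i)) (pd (inl i) a)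
           + smul (xv F p t (oddvar i)) (pd (oddvar i) a)).
HB.lock Definition bv (F : fieldType) (p n : nat) (t : 'I_n -> nat)
  (a : superO F p t) : superO F p t := \sum_i pd (inl i) (pd (oddvar i) a).
HB.lock Definition lap (F : fieldType) (p n : nat) (t : 'I_n -> nat) (c : F)
  (a : superO F p t) : superO F p t :=
  bv a + eul (pd (plast n) a) - c *: pd (plast n) a.
(** The value D_KO(a)(b) as a bilinear operation, with T_H grouped by the pairs i, i'. *)
HB.lock Definition ko (F : fieldType) (p n : nat) (t : 'I_n -> nat)
  (a b : superO F p t) : superO F p t :=
  \sum_i (smul (pd (oddvar i) (sgn a)) (pd (inl i) b)
           + smul (pd (inl i) a) (pd (oddvar i) b))
  + smul (pd (plast n) (sgn a)) (eul b)
  + smul (eul a - 2%:R *: a) (pd (plast n) b).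

Section Operators.

Variables (F : fieldType) (p n : nat) (t : 'I_n -> nat).

Notation O := (superO F p t).
Local Notation "a ** b" := (smul a b) (at level 40, left associativity).
Notation sg := (@sgn F p n t).
Notation dx i := (@pd F p n t (inl i)).
Notation dxi i := (@pd F p n t (oddvar i)).
Notation th := (@pd F p n t (plast n)).
Notation xe i := (xv F p t (inl i)).
Notation xo i := (xv F p t (oddvar i)).
Notation tau := (xv F p t (plast n)).
Notation D := (@eul F p n t).
Notation Dl := (@bv F p n t).
Notation unitO := (unitO F p t).
Notation bas := (@bas F p n t).
Notation xmon := (@xmon F p n t).
Notation parproj := (parproj F p t).
Notation DKO := (DKO F p t).
Notation height := (height p t).
Notation mono := (mono p t).
Notation widen i := (widen_ord (leqnSn n) i).
Implicit Types (a b y z : O) (d e f : bool) (i j : 'I_n) (u v : mono).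
Implicit Types (S T : {set 'I_n.+1}).

Fact smul_linear a : linear (smul a).
Proof. by move=> k b b'; rewrite !smul.unlock linearP. Qed.
HB.instance Definition _ a := GRing.isLinear.Build F O O _ (smul a)
  (smul_linear a).
Fact pd_linear r : linear (@pd F p n t r).
Proof. by move=> k a a'; rewrite !pd.unlock linearP. Qed.
HB.instance Definition _ r := GRing.isLinear.Build F O O _ (@pd F p n t r)
  (pd_linear r).
Fact sgn_linear : linear sg.
Proof. by move=> k a a'; rewrite !sgn.unlock linearP. Qed.
HB.instance Definition _ := GRing.isLinear.Build F O O _ sg sgn_linear.

Lemma smDl a b c : (a + b) ** c = a ** c + b ** c.
Proof. by rewrite !smul.unlock smulDl. Qed.
Lemma smDr a b c : a ** (b + c) = a ** b + a ** c.
Proof. exact: linearD. Qed.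
Lemma smNl a b : (- a) ** b = - (a ** b).
Proof. by rewrite !smul.unlock smulNl. Qed.
Lemma smNr a b : a ** (- b) = - (a ** b).
Proof. exact: linearN. Qed.
Lemma smZl k a b : (k *: a) ** b = k *: (a ** b).
Proof. by rewrite !smul.unlock smulZl. Qed.
Lemma smZr k a b : a ** (k *: b) = k *: (a ** b).
Proof. exact: linearZ. Qed.
Lemma sm0l b : 0 ** b = 0.
Proof. by rewrite !smul.unlock smul0l. Qed.
Lemma sm0r a : a ** 0 = 0.
Proof. exact: linear0. Qed.
Lemma sm_suml I (r : seq I) P (f : I -> O) b :
  (\sum_(i <- r | P i) f i) ** b = \sum_(i <- r | P i) f i ** b.
Proof. by rewrite smul.unlock smul_suml. Qed.
Lemma sm_sumr I (r : seq I) P a (f : I -> O) :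
  a ** (\sum_(i <- r | P i) f i) = \sum_(i <- r | P i) a ** f i.
Proof. exact: linear_sum. Qed.
Lemma sm1l b : unitO ** b = b.
Proof. by rewrite smul.unlock smul1l. Qed.
Lemma sm1r a : a ** unitO = a.
Proof. by rewrite smul.unlock smul1r. Qed.
Lemma smA a b c : (a ** b) ** c = a ** (b ** c).
Proof. by rewrite !smul.unlock smulA. Qed.

Lemma pdD r a b : pd r (a + b) = pd r a + pd r b.
Proof. exact: linearD. Qed.
Lemma pdB r a b : pd r (a - b) = pd r a - pd r b.
Proof. exact: linearB. Qed.
Lemma pdN r a : pd r (- a) = - pd r a.
Proof. exact: linearN. Qed.
Lemma pdZ r k a : pd r (k *: a) = k *: pd r a.
Proof. exact: linearZ. Qed.
Lemma pd0 r : pd r 0 = 0 :> O.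
Proof. exact: linear0. Qed.

Lemma sgD a b : sg (a + b) = sg a + sg b.
Proof. exact: linearD. Qed.
Lemma sgB a b : sg (a - b) = sg a - sg b.
Proof. exact: linearB. Qed.
Lemma sgZ k a : sg (k *: a) = k *: sg a.
Proof. exact: linearZ. Qed.
Lemma sgK : involutive sg.
Proof. by move=> a; rewrite !sgn.unlock psignK. Qed.
Lemma sgM a b : sg (a ** b) = sg a ** sg b.
Proof. by rewrite !sgn.unlock !smul.unlock psign_mul. Qed.

Fact eul_linear : linear D.
Proof.
move=> k a b; rewrite eul.unlock scaler_sumr -big_split; apply: eq_bigr =>
  i _ /=.
by rewrite !linearP /= addrACA -scalerDr.
Qed.
HB.instance Definition _ := GRing.isLinear.Build F O O _ D eul_linear.
Fact bv_linear : linear Dl.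
Proof.
move=> k a b; rewrite bv.unlock scaler_sumr -big_split; apply: eq_bigr =>
  i _ /=.
by rewrite !linearP.
Qed.
HB.instance Definition _ := GRing.isLinear.Build F O O _ Dl bv_linear.

Lemma eulD a b : D (a + b) = D a + D b.
Proof. exact: linearD. Qed.
Lemma eulN a : D (- a) = - D a.
Proof. exact: linearN. Qed.
Lemma eulZ k a : D (k *: a) = k *: D a.
Proof. exact: linearZ. Qed.
Lemma eul0 : D 0 = 0.
Proof. exact: linear0. Qed.
Lemma bvD a b : Dl (a + b) = Dl a + Dl b.
Proof. exact: linearD. Qed.
Lemma bvB a b : Dl (a - b) = Dl a - Dl b.
Proof. exact: linearB. Qed.
Lemma bvZ k a : Dl (k *: a) = k *: Dl a.
Proof. exact: linearZ. Qed.

Lemma eulE a : D a = \sum_i (xe i ** dx i a + xo i ** dxi i a).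
Proof. by rewrite eul.unlock. Qed.
Lemma bvE a : Dl a = \sum_i dx i (dxi i a).
Proof. by rewrite bv.unlock. Qed.
Lemma lapE c a : lap c a = Dl a + D (th a) - c *: th a.
Proof. by rewrite lap.unlock. Qed.
Lemma koE a b : ko a b =
  \sum_i (dxi i (sg a) ** dx i b + dx i a ** dxi i b)
  + th (sg a) ** D b + (D a - 2%:R *: a) ** th b.
Proof. by rewrite ko.unlock. Qed.

Fact lap_linear c : linear (@lap F p n t c).
Proof.
by move=> k a b; rewrite !lapE pdD pdZ bvD bvZ eulD eulZ; coef_ring.
Qed.
HB.instance Definition _ c := GRing.isLinear.Build F O O _ (@lap F p n t c)
  (lap_linear c).
Lemma lapD c a b : lap c (a + b) = lap c a + lap c b.
Proof. exact: linearD. Qed.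
Lemma lapB c a b : lap c (a - b) = lap c a - lap c b.
Proof. exact: linearB. Qed.
Lemma lapN c a : lap c (- a) = - lap c a.
Proof. exact: linearN. Qed.
Lemma lapZ c k a : lap c (k *: a) = k *: lap c a.
Proof. exact: linearZ. Qed.
Lemma eul_euler a : D a = euler F p t a.
Proof.
rewrite eulE smul.unlock pd.unlock xv.unlock /euler sum_lfunE big_sumType.
rewrite big_split; congr (_ + _); apply: eq_bigr => i _;
  exact: (esym (comp_lfunE _ _ _)).
Qed.

Lemma bv_Delta a : Dl a = Delta F p t a.
Proof.
rewrite bvE pd.unlock /Delta sum_lfunE; apply: eq_bigr => i _.
exact: (esym (comp_lfunE _ _ _)).
Qed.

Lemma TH_sum a b : TH a b =
  \sum_(i < n) (lmulO (partial F p t (oddvar i) (psign F p t true a))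
      (partial F p t (inl i) b)
    + lmulO (partial F p t (inl i) a) (partial F p t (oddvar i) b)).
Proof.
rewrite /TH sum_lfunE big_sumType big_split.
congr (_ + _); apply: eq_bigr => i _; rewrite comp_lfunE //.
by rewrite -[in RHS](psign0 a).
Qed.

Lemma ko_DKO a b : ko a b = DKO_fun a b.
Proof.
rewrite koE !eul_euler sgn.unlock smul.unlock pd.unlock.
rewrite /DKO_fun add_lfunE add_lfunE TH_sum.
by rewrite [in RHS](comp_lfunE _ (euler F p t)) [in RHS](comp_lfunE _ (partial
  F p t _)).
Qed.

Lemma lap_divl lambda a : divl p t lambda a = 2%:R *: lap (n%:R * lambda) (sg
  a).
Proof.
rewrite lapE sgn.unlock pd.unlock eul_euler bv_Delta /divl scale_lfunE.
rewrite comp_lfunE add_lfunE comp_lfunE lfunBE scale_lfunE id_lfunE.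
by rewrite addrA.
Qed.

Hypothesis p_char : p \in [pchar F].
Hypothesis p_gt2 : (2 < p)%N.
Hypothesis t_gt0 : forall i, (0 < t i)%N.

Lemma dx_mul i a b : dx i (a ** b) = dx i a ** b + a ** dx i b.
Proof. by rewrite smul.unlock pd.unlock partial_even_mul. Qed.
Lemma dxi_mul i a b : dxi i (a ** b) = dxi i a ** b + sg a ** dxi i b.
Proof. by rewrite smul.unlock pd.unlock sgn.unlock partial_odd_mul. Qed.
Lemma th_mul a b : th (a ** b) = th a ** b + sg a ** th b.
Proof. by rewrite smul.unlock pd.unlock sgn.unlock partial_odd_mul. Qed.

Lemma dx_dx i j a : dx i (dx j a) = dx j (dx i a).
Proof. by rewrite pd.unlock dx_comm. Qed.
Lemma dxi_dx i j a : dxi i (dx j a) = dx j (dxi i a).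
Proof. by rewrite pd.unlock dx_dxi_comm. Qed.
Lemma th_dx j a : th (dx j a) = dx j (th a).
Proof. by rewrite pd.unlock dx_dxi_comm. Qed.
Lemma dxi_dxi i j a : dxi i (dxi j a) = - dxi j (dxi i a).
Proof. rewrite pd.unlock; exact: dxi_anti. Qed.
Lemma th_dxi i a : th (dxi i a) = - dxi i (th a).
Proof. rewrite pd.unlock; exact: dxi_anti. Qed.
Lemma th_sq a : th (th a) = 0.
Proof. rewrite pd.unlock; exact: (dxi_sq p_char p_gt2). Qed.
Lemma sg_dx i a : sg (dx i a) = dx i (sg a).
Proof. rewrite pd.unlock sgn.unlock; exact: psign_dx. Qed.
Lemma sg_dxi i a : sg (dxi i a) = - dxi i (sg a).
Proof. rewrite pd.unlock sgn.unlock; exact: psign_dxi. Qed.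
Lemma sg_th a : sg (th a) = - th (sg a).
Proof. rewrite pd.unlock sgn.unlock; exact: psign_dxi. Qed.

Lemma dx_x i j : dx i (xe j) = (i == j)%:R *: unitO.
Proof. rewrite pd.unlock xv.unlock; exact: dx_xvar. Qed.
Lemma dx_xi i j : dx i (xo j) = 0.
Proof. rewrite pd.unlock xv.unlock; exact: dx_xvar_odd. Qed.
Lemma dx_tau i : dx i tau = 0.
Proof. rewrite pd.unlock xv.unlock; exact: dx_xvar_odd. Qed.
Lemma dxi_x i j : dxi i (xe j) = 0.
Proof. rewrite pd.unlock xv.unlock; exact: dxi_xvar_even. Qed.
Lemma dxi_xi i j : dxi i (xo j) = (i == j)%:R *: unitO.
Proof. by rewrite pd.unlock xv.unlock dxi_xvar; congr (_%:R *: _);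
  rewrite -(inj_eq val_inj). Qed.
Lemma dxi_tau i : dxi i tau = 0.
Proof. by rewrite pd.unlock xv.unlock dxi_xvar -val_eqE /= ltn_eqF ?scale0r.
  Qed.
Lemma th_x j : th (xe j) = 0.
Proof. rewrite pd.unlock xv.unlock; exact: dxi_xvar_even. Qed.
Lemma th_xi j : th (xo j) = 0.
Proof. by rewrite pd.unlock xv.unlock dxi_xvar -val_eqE /= gtn_eqF ?scale0r.
  Qed.
Lemma th_tau : th tau = unitO.
Proof. by rewrite pd.unlock xv.unlock dxi_xvar eqxx scale1r. Qed.
Lemma pd1 r : pd r unitO = 0 :> O.
Proof. by rewrite pd.unlock partial_one. Qed.

Lemma sg_x i : sg (xe i) = xe i.
Proof. by rewrite sgn.unlock xv.unlock (hom_psign _ (hom_xvar_even _ _ _ _))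
  scale1r. Qed.
Lemma sg_xi i : sg (xo i) = - xo i.
Proof. by rewrite sgn.unlock xv.unlock (hom_psign _ (hom_xvar_odd _ _ _ _))
  scaleN1r. Qed.
Lemma sg_tau : sg tau = - tau.
Proof. by rewrite sgn.unlock xv.unlock (hom_psign _ (hom_xvar_odd _ _ _ _))
  scaleN1r. Qed.
Lemma sg1 : sg unitO = unitO.
Proof. by rewrite sgn.unlock (hom_psign _ (hom_one _ _ _)) scale1r. Qed.

Lemma mul_x i a b : a ** (xe i ** b) = xe i ** (a ** b).
Proof.
rewrite -!smA; congr (_ ** _).
by rewrite smul.unlock xv.unlock [RHS](hom_mulC a (hom_xvar_even _ _ _ i))
  psign0.
Qed.
Lemma mul_xi i a b : a ** (xo i ** b) = xo i ** (sg a ** b).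
Proof.
rewrite -!smA; congr (_ ** _); rewrite smul.unlock xv.unlock sgn.unlock.
by rewrite [RHS](hom_mulC _ (hom_xvar_odd _ _ _ _)) psignK.
Qed.
Lemma eul_mul a b : D (a ** b) = D a ** b + a ** D b.
Proof.
rewrite !eulE sm_suml sm_sumr -big_split /=.
apply: eq_bigr => i _; rewrite dx_mul dxi_mul !(smDl, smDr) !smA.
by rewrite mul_xi mul_x; coef_ring.
Qed.

Lemma th_eul a : th (D a) = D (th a).
Proof.
rewrite !eulE linear_sum /=; apply: eq_bigr => i _.
rewrite pdD !th_mul th_x th_xi sg_x sg_xi !sm0l !add0r th_dx th_dxi.
by rewrite smNl smNr opprK.
Qed.

Lemma sg_eul a : sg (D a) = D (sg a).
Proof.
rewrite !eulE linear_sum /=; apply: eq_bigr => i _.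
by rewrite sgD !sgM sg_x sg_xi sg_dx sg_dxi smNl smNr opprK.
Qed.

Lemma dx_eul i a : dx i (D a) = D (dx i a) + dx i a.
Proof.
rewrite !eulE linear_sum /= [X in _ = _ + X](_ : _ = \sum_j (i == j)%:R *: dx j
  a).
  rewrite -big_split; apply: eq_bigr => j _ /=.
  rewrite pdD !dx_mul dx_x dx_xi smZl sm1l sm0l dxi_dx (dx_dx i j).
  by coef_ring.
rewrite (bigD1 i) //= eqxx scale1r big1 ?addr0 // => j /negPf ne.
by rewrite eq_sym ne scale0r.
Qed.

Lemma dxi_eul i a : dxi i (D a) = D (dxi i a) + dxi i a.
Proof.
rewrite !eulE linear_sum /= [X in _ = _ + X](_ : _ = \sum_j (i == j)%:R *: dxi
  j a).
  rewrite -big_split; apply: eq_bigr => j _ /=.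
  rewrite pdD !dxi_mul dxi_x dxi_xi sg_x sg_xi smZl sm1l sm0l.
  by rewrite dxi_dx (dxi_dxi i j) smNl smNr; coef_ring.
rewrite (bigD1 i) //= eqxx scale1r big1 ?addr0 // => j /negPf ne.
by rewrite eq_sym ne scale0r.
Qed.

(** Delta lowers the degree counted by [eul] by 2. *)
Lemma bv_eul a : Dl (D a) = D (Dl a) + 2%:R *: Dl a.
Proof.
rewrite !bvE linear_sum scaler_sumr -big_split /=; apply: eq_bigr => i _.
by rewrite dxi_eul pdD dx_eul; coef_ring.
Qed.

Lemma th_bv a : th (Dl a) = - Dl (th a).
Proof.
rewrite !bvE linear_sum -sumrN; apply: eq_bigr => i _ /=.
by rewrite th_dx th_dxi pdN.
Qed.

Lemma sg_bv a : sg (Dl a) = - Dl (sg a).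
Proof.
rewrite !bvE linear_sum -sumrN; apply: eq_bigr => i _ /=.
by rewrite sg_dx sg_dxi pdN.
Qed.

Lemma bv_sq a : Dl (Dl a) = 0.
Proof.
(* The odd derivations anticommute and all other pairs commute, so exchanging i and j in the double
   sum changes its sign. *)
have e : Dl (Dl a) = - Dl (Dl a).
  transitivity (\sum_i \sum_j dx i (dxi i (dx j (dxi j a)))).
    by rewrite bvE; apply: eq_bigr => i _; rewrite bvE !linear_sum.
  rewrite bvE -sumrN exchange_big; apply: eq_bigr => i _ /=.
  rewrite bvE !linear_sum; apply: eq_bigr => j _ /=.
  by rewrite !dxi_dx dxi_dxi !pdN dx_dx.
move/eqP: e; rewrite -addr_eq0 -mulr2n -scaler_nat scaler_eq0.
by rewrite (negPf (two_neq0 p_char p_gt2)) => /eqP.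
Qed.

(** Delta has order two: up to signs, the sum is the odd Poisson (Buttin) bracket of a and b. *)
Lemma bv_mul a b : Dl (a ** b) = Dl a ** b + sg a ** Dl b +
  \sum_i (dxi i a ** dx i b + sg (dx i a) ** dxi i b).
Proof.
rewrite !bvE sm_suml sm_sumr -!big_split /=.
by apply: eq_bigr => i _; rewrite dxi_mul pdD !dx_mul sg_dx; coef_ring.
Qed.

Lemma lap_shift c c' a : lap c a = lap c' a + (c' - c) *: th a.
Proof. by rewrite !lapE; coef_ring. Qed.

(** The 2 comes from [bv_eul]; Delta and the last odd derivative have square zero and anticommute.
    The composite vanishes for c' = c + 2. *)
Lemma lap_lap c c' a : lap c (lap c' a) = (2%:R + c - c') *: Dl (th a).
Proof.
rewrite (lapE c') lapB lapD lapZ !lapE bv_sq !th_eul !th_sq !th_bv bv_eul eulN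
  !eul0.
by coef_ring.
Qed.

Lemma th_lap c a : th (lap c a) = - lap c (th a).
Proof.
by rewrite !lapE pdB pdD pdZ !th_eul !th_sq th_bv !eul0; coef_ring.
Qed.

Lemma sg_lap c a : sg (lap c a) = - lap c (sg a).
Proof.
by rewrite !lapE sgB sgD sgZ sg_bv sg_eul !sg_th eulN; coef_ring.
Qed.

(* Contact vector fields come from commutators with the second order operator  *)
(* lap c, for every value of the parameter c.                                  *)
Lemma ko_lap c a b : ko a b =
  lap c (sg a ** b) - a ** lap (c - 2%:R) b - lap c (sg a) ** b.
Proof.
rewrite koE !lapE bv_mul th_mul sgK.
under [in RHS]eq_bigr do rewrite sg_dx sgK.
rewrite eulD !eul_mul !(smDl, smDr, smNl, smNr, smZl, smZr).
by coef_ring.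
Qed.

Lemma eul_x i : D (xe i) = xe i.
Proof.
rewrite eulE (bigD1 i) //= big1 => [|j /negPf ne].
  by rewrite dx_x // dxi_x eqxx scale1r sm1r sm0r !addr0.
by rewrite dx_x // dxi_x ne scale0r !sm0r addr0.
Qed.

Lemma eul_xi i : D (xo i) = xo i.
Proof.
rewrite eulE (bigD1 i) //= big1 => [|j /negPf ne].
  by rewrite dx_xi dxi_xi eqxx scale1r sm1r sm0r add0r addr0.
by rewrite dx_xi dxi_xi ne scale0r !sm0r addr0.
Qed.

Lemma eul_tau : D tau = 0.
Proof. by rewrite eulE big1 // => j _; rewrite dx_tau dxi_tau !sm0r addr0. Qed.

Lemma eul1 : D unitO = 0.
Proof. by rewrite eulE big1 // => j _; rewrite !pd1 !sm0r addr0. Qed.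

(** * The bracket of contact vector fields *)

Definition sgk e a : O := if e then sg a else a.

Lemma par_mulC e a b : has_parity e a -> a ** b = sgk e b ** a.
Proof.
move=> ha; rewrite smul.unlock (hom_mulC b ha) /sgk sgn.unlock.
by case: e {ha} => //; rewrite psign0.
Qed.

Lemma par_mulCA e a b z : has_parity e a -> a ** (b ** z) = sgk e b ** (a ** z).
Proof. by move=> ha; rewrite -!smA (par_mulC b ha). Qed.

Lemma par_sg d a : has_parity d a -> sg a = (-1) ^+ d *: a.
Proof. by move=> ha; rewrite sgn.unlock (hom_psign true ha). Qed.

Lemma sgk_par k d a : has_parity d a -> sgk k a = (-1) ^+ (k && d) *: a.
Proof. by case: k => ha; rewrite /sgk ?(par_sg ha) ?scale1r. Qed.

Lemma par_dx i d a : has_parity d a -> has_parity d (dx i a).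
Proof. rewrite pd.unlock; exact: hom_dx. Qed.
Lemma par_dxi i d a : has_parity d a -> has_parity (~~ d) (dxi i a).
Proof. rewrite pd.unlock; exact: hom_dxi. Qed.
Lemma par_th d a : has_parity d a -> has_parity (~~ d) (th a).
Proof. rewrite pd.unlock; exact: hom_dxi. Qed.
Lemma par_sgn d a : has_parity d a -> has_parity d (sg a).
Proof. by move=> ha; rewrite (par_sg ha); apply: homZ. Qed.
Lemma par_mul d e a b : has_parity d a -> has_parity e b ->
  has_parity (d (+) e) (a ** b).
Proof. rewrite smul.unlock; exact: hom_mul. Qed.
Lemma par_eul d a : has_parity d a -> has_parity d (D a).
Proof.
move=> ha; rewrite eulE; apply: hom_sum => i _; apply: homD.
  rewrite -[d]addFb; apply: par_mul (par_dx _ ha).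
  by rewrite xv.unlock; apply: hom_xvar_even.
rewrite -[d]negbK -addTb; apply: par_mul (par_dxi _ ha).
by rewrite xv.unlock; apply: hom_xvar_odd.
Qed.

(** The field D_KO(a) has the parity opposite to that of a, hence the sign [sgk (~~ d)]. *)
Lemma ko_derivation d a b z : has_parity d a ->
  ko a (b ** z) = ko a b ** z + sgk (~~ d) b ** ko a z.
Proof.
move=> ha; have hs := par_sgn ha.
have hD : has_parity d (D a - 2%:R *: a).
  by apply: homB (par_eul ha) (homZ _ ha).
rewrite !koE; move: (D a - _) hD => w hw.
rewrite eul_mul // th_mul // [in RHS]smDl [in RHS]smDl [in RHS]smDr [in
  RHS]smDr.
rewrite sm_suml sm_sumr ![in LHS]smDr !smA.
rewrite (par_mulCA b _ (par_th hs)) (par_mulCA (sg b) _ hw).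
have -> : sgk d (sg b) = sgk (~~ d) b by case: (d); rewrite /sgk ?sgK.
have -> : \sum_i (dxi i (sg a) ** dx i (b ** z) + dx i a ** dxi i (b ** z)) =
  \sum_i (dxi i (sg a) ** dx i b + dx i a ** dxi i b) ** z +
  \sum_i sgk (~~ d) b ** (dxi i (sg a) ** dx i z + dx i a ** dxi i z).
  rewrite -big_split /=; apply: eq_bigr => i _.
  rewrite dx_mul // dxi_mul // !smDr !smDl !smA.
  rewrite (par_mulCA b _ (par_dxi i hs)) (par_mulCA (sg b) _ (par_dx i ha)).
  have -> : sgk d (sg b) = sgk (~~ d) b by case: (d); rewrite /sgk ?sgK.
  by coef_ring.
by coef_ring.
Qed.

Lemma lap_th c z : lap c (th z) = bv (th z).
Proof. by rewrite lapE th_sq // eul0 scaler0 subr0 addr0. Qed.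

Lemma lap_lap0 c z : lap (c - 2%:R) (lap c z) = 0.
Proof. by rewrite lap_lap // (_ : _ - c = 0) ?scale0r //; ring. Qed.

Lemma lap_pred c z : lap (c - 2%:R) z = lap c z + 2%:R *: th z.
Proof. by rewrite (lap_shift _ c); congr (_ + _ *: _); ring. Qed.

Lemma lap_sq c z : lap c (lap c z) = 2%:R *: bv (th z).
Proof. by rewrite lap_lap // addrK. Qed.

Section Kernel.

Variables (c : F) (d : bool) (a : O).
Hypotheses (ha : has_parity d a) (ka : lap c a = 0).

Lemma ko_ker z : ko a z = (-1) ^+ d *: lap c (a ** z) - a ** lap (c - 2%:R) z.
Proof.
rewrite (ko_lap c) (par_sg ha) smZl !lapZ ka scaler0 sm0l.
by rewrite subr0.
Qed.

Lemma th_mul_par z : th (a ** z) = th a ** z + (-1) ^+ d *: (a ** th z).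
Proof. by rewrite th_mul (par_sg ha) smZl. Qed.

(** Were [lap c] of square zero and used in both terms of [ko_ker], this supercommutator would be 0.
    The shift by 2 and [lap_sq] leave two terms in th, which [th_mul_par] combines. *)
Lemma ko_lap_ker z :
  ko a (lap c z) + (-1) ^+ d *: lap c (ko a z) = 2%:R *: lap c (th a ** z).
Proof.
have e := th_mul_par z; move/(canRL (addrK _)): (esym e) => ->.
rewrite !ko_ker lap_lap0 lap_pred sm0r subr0 smDr smZr.
rewrite !(lapB, lapD, lapZ) lap_sq lap_th.
by case: (d); rewrite /= ?expr0 ?expr1; coef_ring.
Qed.

(** Needed alongside [ko_lap_ker] because [ko_ker] involves both parameters c and c - 2. *)
Lemma ko_lap_pred_ker z :
  ko a (lap (c - 2%:R) z) + (-1) ^+ d *: lap (c - 2%:R) (ko a z) =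
  - (2%:R * (-1) ^+ d) *: (th a ** lap (c - 2%:R) z).
Proof.
have e := th_mul_par (lap (c - 2%:R) z).
rewrite !ko_ker !(lapB, lapZ) lap_lap0 scaler0 sub0r lap_sq.
rewrite [lap (c - 2%:R) (a ** _)]lap_pred e th_lap // lap_th // !smZr smNr.
by case: (d); rewrite /= ?expr0 ?expr1; coef_ring.
Qed.

End Kernel.

(** Generating function of the bracket of D_KO(a) and D_KO(b); on the kernel of [lap c], [kobrE]
    identifies it with the usual contact bracket. *)
Definition kobr c a b := lap (c + 2%:R) (sg a ** b).

Lemma lap_kobr c a b : lap c (kobr c a b) = 0.
Proof. by rewrite /kobr lap_lap // opprD addrA addrK subrr scale0r. Qed.

Lemma kobrE c d a b : has_parity d a -> lap c a = 0 -> lap c b = 0 ->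
  kobr c a b = ko a b - (2%:R * (-1) ^+ d) *: (th a ** b).
Proof.
move=> ha ka kb; rewrite (ko_ker ha ka) lap_pred kb add0r /kobr.
rewrite (lap_shift _ c) (par_sg ha) smZl lapZ pdZ (th_mul_par ha) smZr.
by case: (d); rewrite /= ?expr0 ?expr1; coef_ring.
Qed.

Lemma par_kobr c d e a b : has_parity d a -> has_parity e b ->
  has_parity (~~ (d (+) e)) (kobr c a b).
Proof.
move=> ha hb; have h := par_mul (par_sgn ha) hb.
have hl f z : has_parity f z -> has_parity (~~ f) (lap (c + 2%:R) z).
  move=> hz; rewrite lapE; apply: homB; last exact/homZ/par_th.
  apply: homD; last exact/par_eul/par_th.
  rewrite bvE; apply: hom_sum => i _; exact/par_dx/par_dxi.
exact: hl.
Qed.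

(** By [ko_ker], [ko b] is a twisted commutator of [lap] with the multiplication by b; [ko a] is
    then moved past [lap] by the two commutation lemmas and past products by the derivation rule.
    This replaces an expansion of contact fields in coordinates. *)
Lemma ko_bracket c d e a b z :
  has_parity d a -> has_parity e b -> lap c a = 0 -> lap c b = 0 ->
  ko a (ko b z) - (-1) ^+ (~~ d && ~~ e) *: ko b (ko a z) = ko (kobr c a b) z.
Proof.
move=> ha hb ka kb.
have hk := par_kobr c ha hb; have kk := lap_kobr c a b.
rewrite (ko_ker hk kk) (kobrE ha ka kb) (ko_ker hb kb) (ko_ker hb kb (ko a z)).
have koB y y' : ko a (y - y') = ko a y - ko a y' by rewrite !(ko_ker ha ka)
  smDr smNr !(lapB, lapD, lapN) smDr smNr; coef_ring.
have koZ k y : ko a (k *: y) = k *: ko a y by rewrite !(ko_ker ha ka) smZr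
  !lapZ smZr; coef_ring.
have e1 := ko_lap_ker ha ka (b ** z).
have e2 := ko_lap_pred_ker ha ka z.
move/(canRL (addrK _)): e1 => e1; move/(canRL (addrK _)): e2 => e2.
rewrite koB koZ e1 (ko_derivation b (lap _ _) ha) (ko_derivation b z ha) e2.
rewrite !(smDl, smNl, smZl).
rewrite !(sgk_par _ hb) !(smDr, smNr, smZr, smZl).
have e3 y : b ** (th a ** y) = (-1) ^+ (~~ d && e) *: (th a ** (b ** y)).
  rewrite (par_mulCA b y (par_th ha)) (sgk_par _ hb) smZl scalerA -expr2
    sqrr_sign.
  by rewrite scale1r.
rewrite e3 !smA !(lapB, lapD, lapN, lapZ).
by case: (d) (e) => -[]; rewrite /= ?expr0 ?expr1; coef_ring.
Qed.

Lemma DKO_ko a z : DKO a z = ko a z.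
Proof. by rewrite DKOE ko_DKO. Qed.

Lemma par_ko d e a z : has_parity d a -> has_parity e z ->
  has_parity (~~ d (+) e) (ko a z).
Proof.
move=> ha hz; have hs := par_sgn ha.
have hD : has_parity d (D a - 2%:R *: a).
  by apply: homB (par_eul ha) (homZ _ ha).
rewrite koE; move: (D a - _) hD => w hw; apply: homD; [apply: homD|].
- apply: hom_sum => i _; apply: homD; first exact: par_mul (par_dxi _ hs)
  (par_dx _ hz).
  by have := par_mul (par_dx i ha) (par_dxi i hz); rewrite addbN -addNb.
- exact: par_mul (par_th hs) (par_eul hz).
by have := par_mul hw (par_th hz); rewrite addbN -addNb.
Qed.

Lemma homog_DKO e a : homog e (DKO a) = DKO (parproj (~~ e) a).
Proof.
apply/lfunP => z; rewrite /homog sum_lfunE.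
under eq_bigr => d _ do rewrite comp_lfunE comp_lfunE.
have split2 (A : O -> O) : {morph A : x y / x + y} ->
    A z = \sum_(d : bool) A (parproj d z).
  by move=> hA; rewrite big_bool /= -hA addrC -parproj_sum.
rewrite (split2 (DKO (parproj (~~ e) a))); last by move=> x y; rewrite linearD.
apply: eq_bigr => d _; have hz := parproj_id d z.
rewrite {1}[a]parproj_sum linearD /= add_lfunE linearD /= !DKO_ko.
have h0 := par_ko (parproj_id false a) hz.
have h1 := par_ko (parproj_id true a) hz.
rewrite (hom_parproj _ h0) (hom_parproj _ h1).
by case: d {hz h0 h1}; case: e => /=; rewrite ?addr0 ?add0r.
Qed.

Lemma par_lap c d a : has_parity d a -> has_parity (~~ d) (lap c a).
Proof.
move=> ha; rewrite lapE; apply: homB; last exact/homZ/par_th.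
apply: homD; last exact/par_eul/par_th.
rewrite bvE; apply: hom_sum => i _; exact/par_dx/par_dxi.
Qed.

Lemma lap_parproj c e a : lap c a = 0 -> lap c (parproj e a) = 0.
Proof.
rewrite {1}[a]parproj_sum lapD => h.
have h0 := par_lap c (parproj_id false a).
have h1 := par_lap c (parproj_id true a).
case: e.
  have := congr1 (parproj false) h; rewrite linearD linear0 /=.
  by rewrite (hom_parproj _ h0) (hom_parproj _ h1) /= add0r.
have := congr1 (parproj true) h; rewrite linearD linear0 /=.
by rewrite (hom_parproj _ h0) (hom_parproj _ h1) /= addr0.
Qed.

Lemma kobr_suml c a b : kobr c a b = \sum_(d : bool) kobr c (parproj d a) b.
Proof.
by rewrite big_bool /= /kobr -lapD -smDl -sgD [parproj _ _ + _]addrC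
  -parproj_sum.
Qed.

Lemma kobr_sumr c a b : kobr c a b = \sum_(e : bool) kobr c a (parproj e b).
Proof. by rewrite big_bool /= /kobr -lapD -smDr [parproj _ _ + _]addrC
  -parproj_sum. Qed.

Lemma sbr_DKO c a b : lap c a = 0 -> lap c b = 0 ->
  sbr (DKO a) (DKO b) = DKO (kobr c a b).
Proof.
move=> ka kb; rewrite kobr_suml linear_sum /sbr.
(* [DKO] reverses parity: the component d of a field comes from the component [~~ d] of its
   function. *)
rewrite [RHS](reindex_inj negb_inj) /=; apply: eq_bigr => d _.
rewrite kobr_sumr linear_sum [RHS](reindex_inj negb_inj) /=; apply: eq_bigr =>
  e _.
rewrite !homog_DKO; apply/lfunP => z; rewrite lfunBE scale_lfunE !comp_lfunE
  !DKO_ko.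
have := ko_bracket z (parproj_id (~~ d) a) (parproj_id (~~ e) b)
  (lap_parproj _ ka) (lap_parproj _ kb).
by rewrite !negbK.
Qed.

(** Applying D_KO(a) = 0 to x_(2n+1) gives D(a) = 2 a; the other variables express the remaining
    first derivatives of a through th a. Then all derivatives of th a entering D vanish, so 2 th a =
    D(th a) = 0; hence the first derivatives of a vanish as well, D(a) = 0 and a = 0. *)
Lemma lker_DKO : lker DKO = 0%VS.
Proof.
apply/eqP; rewrite -subv0; apply/subvP => a; rewrite memv_ker memv0 => /eqP a0.
have ko0 z : ko a z = 0 by rewrite -DKO_ko a0 zero_lfunE.
have sg0 z : sg z = 0 -> z = 0.
  by move/(congr1 sg); rewrite sgK => ->; rewrite linear0.
have Da : D a = 2%:R *: a.
  have := ko0 tau; rewrite koE eul_tau sm0r th_tau sm1r big1 ?add0r ?addr0 =>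
    [/eqP|j _].
    by rewrite subr_eq0 => /eqP.
  by rewrite dx_tau dxi_tau !sm0r addr0.
have h1 i : dxi i (sg a) + th (sg a) ** xe i = 0.
  have := ko0 (xe i); rewrite koE eul_x th_x sm0r addr0 (bigD1 i) //= big1 =>
    [|j /negPf ne].
    by rewrite dx_x // dxi_x eqxx scale1r sm1r sm0r !addr0.
  by rewrite dx_x // dxi_x ne scale0r !sm0r addr0.
have h2 i : dx i a + th (sg a) ** xo i = 0.
  have := ko0 (xo i); rewrite koE eul_xi th_xi sm0r addr0 (bigD1 i) //= big1 =>
    [|j /negPf ne].
    by rewrite dx_xi dxi_xi eqxx scale1r sm1r sm0r add0r !addr0.
  by rewrite dx_xi dxi_xi ne scale0r !sm0r addr0.
have dth i : dx i (th a) = 0.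
  have := congr1 th (h2 i); rewrite pdD th_mul th_xi sm0r addr0 th_sq // sm0l.
  by rewrite addr0 th_dx pd0.
have dxith i : dxi i (th a) = 0.
  have := congr1 th (h1 i); rewrite pdD th_mul th_x sm0r addr0 th_sq // sm0l.
  rewrite addr0 th_dxi // pd0 => /eqP; rewrite oppr_eq0 => /eqP e.
  by apply: sg0; rewrite sg_dxi sg_th pdN opprK.
have two0 z : 2%:R *: z = 0 -> z = 0.
  by move/eqP; rewrite scaler_eq0 (negPf (two_neq0 p_char p_gt2)) => /eqP.
have tha : th a = 0.
  apply: two0; rewrite -pdZ -Da th_eul // eulE big1 // => i _.
  by rewrite dth dxith !sm0r addr0.
apply/eqP/two0; rewrite -Da eulE big1 // => i _.
have ths : th (sg a) = 0 by rewrite -[th _]opprK -sg_th tha linear0 oppr0.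
have := h1 i; have := h2 i; rewrite ths !sm0l !addr0 => -> e.
by rewrite (sg0 (dxi i a)) ?sm0r ?addr0 // sg_dxi e oppr0.
Qed.

(** * The Berezin integral and the derived algebras *)

Definition top : mono := mkmono p t height setT.

Lemma expo_top i : expo top i = height i.
Proof. exact: expo_mkmono. Qed.

(** The Berezin integral: derivatives have coefficient 0 at the top monomial, which gives
    integration by parts. *)
Definition berezin (a : O) : F^o := coef a top.

Fact berezin_linear : linear berezin.
Proof. by move=> k a b; rewrite /berezin ocoefD ocoefZ. Qed.
HB.instance Definition _ := GRing.isLinear.Build F O F^o _ berezin
  berezin_linear.

Lemma berezinD a b : berezin (a + b) = berezin a + berezin b. Proof. exact:
  linearD. Qed.
Lemma berezinN a : berezin (- a) = - berezin a. Proof. exact: linearN. Qed.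
Lemma berezinB a b : berezin (a - b) = berezin a - berezin b. Proof. exact:
  linearB. Qed.
Lemma berezinZ k a : berezin (k *: a) = k * berezin a. Proof. exact: linearZ.
  Qed.
Lemma berezin0 : berezin 0 = 0. Proof. exact: linear0. Qed.

Lemma berezin_pd r a : berezin (pd r a) = 0.
Proof.
rewrite pd.unlock [a]basis_sum !linear_sum big1 // => u _.
rewrite !linearZ /= /berezin; suff -> : coef (partial F p t r (bas u)) top = 0.
  exact: mulr0.
case: r => [i|s].
  rewrite partial_xmon_even ?expo_le //; case: eqP => ui; first exact: ocoef0.
  rewrite coef_xmon; case: forallP => //= /(_ i) /eqP.
  by rewrite expo_top eqxx => e; have := expo_le u i; rewrite e; lia.
rewrite partial_xmon_odd; case: ifP => _; last exact: ocoef0.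
rewrite ocoefZ coef_xmon; case: eqP => [|_]; last by rewrite andbF mulr0.
by move/setP/(_ s); rewrite !inE eqxx.
Qed.

Lemma berezin_dx i a b : berezin (dx i a ** b) = - berezin (a ** dx i b).
Proof. by apply/eqP; rewrite -addr_eq0 -berezinD -dx_mul // berezin_pd. Qed.
Lemma berezin_dxi i a b : berezin (dxi i a ** b) = - berezin (sg a ** dxi i b).
Proof. by apply/eqP; rewrite -addr_eq0 -berezinD -dxi_mul berezin_pd. Qed.
Lemma berezin_th a b : berezin (th a ** b) = - berezin (sg a ** th b).
Proof. by apply/eqP; rewrite -addr_eq0 -berezinD -th_mul berezin_pd. Qed.

(** Integrating by parts, each x_i contributes minus the integral of a and its odd partner plus the
    same: D has divergence zero. *)
Lemma berezin_eul a : berezin (D a) = 0.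
Proof.
rewrite eulE linear_sum big1 //= => i _; rewrite berezinD.
have /eqP := berezin_pd (inl i) (xe i ** a).
rewrite dx_mul // dx_x // eqxx scale1r sm1l berezinD addrC addr_eq0 => /eqP ->.
have /eqP := berezin_pd (oddvar i) (xo i ** a).
rewrite dxi_mul dxi_xi eqxx scale1r sm1l sg_xi smNl berezinB subr_eq0 =>
  /eqP ->.
by rewrite addNr.
Qed.

Lemma berezin_bv a b : berezin (bv a ** b) = berezin (sg a ** bv b).
Proof.
rewrite !bvE sm_suml sm_sumr !linear_sum; apply: eq_bigr => i _ /=.
by rewrite berezin_dx // berezin_dxi // opprK dxi_dx.
Qed.

(** As D has divergence zero, passing to the adjoint only negates the constant. The equation - (c +
    2) = c holds exactly for c = -1, whence the exceptional value. *)
Lemma berezin_lap c a b : berezin (lap c a ** b) = berezin (sg a ** lap (- c)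
  b).
Proof.
have e : berezin (D (th a) ** b) = - berezin (th a ** D b).
  by apply/eqP; rewrite -addr_eq0 -berezinD -eul_mul // berezin_eul.
rewrite !lapE !smDl !smDr smNl smZl smNr smZr !berezinD !berezinN !berezinZ
  berezin_bv e.
by rewrite !berezin_th -th_eul //; ring.
Qed.

Lemma berezin_kernel c a b : c = -1 -> lap c b = 0 ->
  berezin (sg (lap (c + 2%:R) a) ** b) = 0.
Proof.
move=> ec kb; rewrite sg_lap smNl berezinN berezin_lap sgK (_ : - (c + 2%:R) =
  c) ?kb.
  by rewrite sm0r berezin0 oppr0.
by rewrite ec; ring.
Qed.

(** Used with 1 in place of c: a function killed by [lap 1] has integral 0. So for c = -1 the
    functions of integral 0 contain the kernel of [lap (c + 2)], and their image has codimension
    exactly one in the full image. *)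
Lemma berezin_tau_lap c a : berezin (tau ** lap c a) = - c * berezin a.
Proof.
have bt : bv tau = 0.
  by rewrite bvE big1 // => j _; rewrite dxi_tau pd0.
have e1 : berezin (tau ** bv a) = 0.
  by have /eqP := berezin_bv tau a; rewrite bt sm0l berezin0 sg_tau smNl
    berezinN eq_sym oppr_eq0 => /eqP.
have e2 : berezin (tau ** D (th a)) = 0.
  by have := berezin_eul (tau ** th a); rewrite eul_mul // eul_tau sm0l add0r.
have e3 : berezin (tau ** th a) = berezin a.
  by have /eqP := berezin_th tau a; rewrite th_tau sm1l sg_tau smNl berezinN
    opprK => /eqP.
by rewrite lapE smDr smDr smNr smZr !berezinD berezinN berezinZ e1 e2 e3; ring.
Qed.

Definition lapf (c : F) : 'End(O) := linfun (@lap F p n t c).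
Definition berezinf : 'Hom(O, F^o) := linfun berezin.

Lemma lapfE c a : lapf c a = lap c a. Proof. exact: lfunE. Qed.
Lemma berezinfE a : berezinf a = berezin a. Proof. exact: lfunE. Qed.

(* When c = -1, lap (c + 2) is the formal adjoint of lap c, so the brackets of *)
(* elements of its image come from elements of integral 0.                     *)
Definition potentials (c : F) : {vspace O} := if c + 1 == 0 then lker berezinf
  else fullv.
Definition koimg (c : F) : {vspace O} := (lapf (c + 2%:R) @: potentials c)%VS.

Lemma potentialsP c a : reflect (c + 1 = 0 -> berezin a = 0) (a \in potentials
  c).
Proof.
rewrite /potentials; case: eqP => [e|ne].
  by rewrite memv_ker berezinfE; apply: (iffP eqP) => [->|->].
by rewrite memvf; left.
Qed.

Lemma koimgP c a :
  reflect (exists2 u, c + 1 = 0 -> berezin u = 0 & a = lap (c + 2%:R) u) (a \in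
    koimg c).
Proof.
apply: (iffP memv_imgP) => [[u /potentialsP hu ->]|[u hu ->]]; exists u => //.
- exact: lapfE.
- exact/potentialsP.
- by rewrite lapfE.
Qed.

Lemma koimg_ker c a : a \in koimg c -> lap c a = 0.
Proof.
case/koimgP => u _ ->; rewrite lap_lap // (_ : _ - _ = 0) ?scale0r //; ring.
Qed.

Section Derived.

Variable lambda : F.
Notation c := (n%:R * lambda).

Lemma ker_divl a : (a \in lker (divl p t lambda)) = (lap c a == 0).
Proof.
rewrite memv_ker lap_divl scaler_eq0 (negPf (two_neq0 p_char p_gt2)) /=.
by rewrite -[lap c (sg a)]opprK -sg_lap oppr_eq0 (can2_eq sgK sgK) linear0.
Qed.

Lemma SKO1_sub : (SKO1 p t lambda <= DKO @: limg (lapf (c + 2%:R)))%VS.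
Proof.
apply/brspaceP => _ _ /memv_imgP[a ka ->] /memv_imgP[b kb ->].
rewrite !ker_divl in ka kb.
rewrite (sbr_DKO (eqP ka) (eqP kb)) memv_img //.
by rewrite /kobr -lapfE memv_img ?memvf.
Qed.

(** The second derivation brings in the integral: [berezin_kernel] wants the first factor in the
    image of [lap (c + 2)], which [SKO1_sub] provides for g'. *)
Lemma SKO_sub : (SKO p t lambda <= DKO @: koimg c)%VS.
Proof.
apply/brspaceP => X Y /(subvP SKO1_sub)/memv_imgP[_ /memv_imgP[u _ ->] ->].
move=> /(subvP SKO1_sub)/memv_imgP[_ /memv_imgP[v _ ->] ->].
rewrite !lapfE; have ku w : lap c (lap (c + 2%:R) w : O) = 0.
  by rewrite lap_lap // (_ : _ - _ = 0) ?scale0r //; ring.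
rewrite (sbr_DKO (ku u) (ku v)) memv_img //.
apply/koimgP; exists (sg (lap (c + 2%:R) u) ** lap (c + 2%:R) v) => // e.
by apply: berezin_kernel (ku v); apply/eqP; rewrite -addr_eq0 e.
Qed.

Lemma brspace_sub (U U' V V' : {vspace 'End(O)}) :
  (U <= U')%VS -> (V <= V')%VS -> (brspace U V <= brspace U' V')%VS.
Proof.
move=> /subvP sU /subvP sV; apply/brspaceP => X Y XU YV.
by apply: mem_brspace; [apply: sU | apply: sV].
Qed.

(** As W lies in g'' and in [W, W], monotonicity of brackets puts it in g' and then in g. Generation
    is phrased through an arbitrary subspace B of O, so that it can be checked on functions; the
    proof takes for B a preimage under [DKO]. *)
Lemma sub_SKO :
  (forall B : {vspace O}, (forall a b, a \in koimg c -> b \in koimg c ->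
    kobr c a b \in B) ->
     (koimg c <= B)%VS) ->
  (DKO @: koimg c <= SKO p t lambda)%VS.
Proof.
move=> gen; set W := (DKO @: koimg c)%VS.
have WW : (W <= brspace W W)%VS.
  rewrite /W; apply/subvP => _ /memv_imgP[w ww ->]; rewrite memv_preim.
  apply: (subvP (gen _ _)) ww => a b wa wb; rewrite -memv_preim.
  rewrite -(sbr_DKO (koimg_ker wa) (koimg_ker wb)).
  by apply: mem_brspace; apply: memv_img.
have W2 : (W <= SKO2 p t lambda)%VS.
  by apply: limgS; apply/subvP => a /koimg_ker; rewrite ker_divl => ->.
have W1 : (W <= SKO1 p t lambda)%VS.
  exact: subv_trans WW (brspace_sub W2 W2).
exact: subv_trans WW (brspace_sub W1 W1).
Qed.

Lemma dim_potentials : (\dim (potentials c) + (c + 1 == 0)%R = \dim {: O})%N.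
Proof.
rewrite /potentials; case: eqP => _; rewrite ?addn0 //.
rewrite -(limg_ker_dim berezinf fullv) capfv; congr (_ + _)%N.
apply/esym/eqP; rewrite eqn_leq (leq_trans (dimvS (subvf _))) ?dimvf //=.
rewrite lt0n dimv_eq0; apply: contraTneq (memv_img berezinf (memvf (bas top)))
  => ->.
by rewrite memv0 berezinfE /berezin coef_bas eqxx oner_eq0.
Qed.

Lemma dim_koimg : (\dim (koimg c) + (c + 1 == 0)%R = \dim (limg (lapf (c +
  2%:R)%R)))%N.
Proof.
apply/eqP; rewrite -(eqn_add2l (\dim (lker (lapf (c + 2%:R)%R)))); apply/eqP.
have e : (potentials c :&: lker (lapf (c + 2%:R)))%VS = lker (lapf (c + 2%:R)).
  apply/capv_idPr/subvP => a; rewrite memv_ker lapfE => /eqP a0.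
  apply/potentialsP => e; have := berezin_tau_lap (c + 2%:R) a.
  rewrite a0 sm0r berezin0 (_ : c + 2%:R = 1); first by rewrite mulN1r =>
    /esym/eqP; rewrite oppr_eq0 => /eqP.
  by rewrite -[RHS]add0r -e; ring.
rewrite addnA -{1}e limg_ker_dim dim_potentials -(limg_ker_dim (lapf (c +
  2%:R)) fullv).
by rewrite capfv.
Qed.

End Derived.

(** * Generation by brackets *)

Lemma height_opp1 i : (height i)%:R = -1 :> F.
Proof.
apply/eqP; rewrite -addr_eq0 natr1 prednK; last first.
  by rewrite expn_gt0 (ltn_trans _ p_gt2).
by rewrite natrX pcharf0 // expr0n gtn_eqF.
Qed.

Lemma x_dx_bas i u : xe i ** dx i (bas u) = (expo u i)%:R *: bas u.
Proof.
rewrite smul.unlock pd.unlock xv.unlock partial_xmon_even ?expo_le //.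
case: eqP => [->|/eqP ui]; first by rewrite linear0 scale0r.
rewrite mul_xmon disjoints_subset sub0set set0U inversionsE big_set0 mul1r.
congr (_ *: _).
  rewrite (bincoef_split _ i) eqxx [X in _ * X](_ : _ = 1) ?mulr1.
    by rewrite bin1 subnKC ?lt0n.
  by rewrite big1 // => j /negPf ->; rewrite bin0.
apply: eq_xmon => j; case: eqP => [->|_]; last by rewrite subn0.
by rewrite add1n subn1 prednK ?lt0n.
Qed.

Lemma xi_dxi_bas (s : 'I_n.+1) u :
  xv F p t (inr s) ** pd (inr s) (bas u) = (s \in u.2)%:R *: bas u.
Proof.
rewrite smul.unlock pd.unlock xv.unlock partial_xmon_odd.
case: ifP => su; last by rewrite linear0 scale0r.
rewrite linearZ /= mul_xmon disjoints1 !inE eqxx /= setD1K // scalerA mulrA.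
rewrite -expr2 sqrr_sign mul1r /bincoef big1 ?scale1r //.
by move=> j _; rewrite bin0.
Qed.

Lemma eul_bas u : D (bas u) =
  (\sum_i (expo u i + (widen i \in u.2)))%N%:R *: bas u.
Proof.
rewrite eulE natr_sum scaler_suml; apply: eq_bigr => i _.
by rewrite x_dx_bas xi_dxi_bas natrD scalerDl.
Qed.

(** Up to sign the action of D_KO(x_i x_(i')); monomials are eigenvectors, with weights that tell
    them apart. *)
Definition wt i z : O := xe i ** dx i z - xo i ** dxi i z.

Lemma wt_bas i u : wt i (bas u) = ((expo u i)%:R - (widen i \in u.2)%:R) *: bas
  u.
Proof. by rewrite /wt x_dx_bas xi_dxi_bas scalerBl. Qed.

Lemma ko1 z : ko unitO z = - 2%:R *: th z.
Proof.
rewrite koE sg1 eul1 sub0r smNl smZl sm1l !pd1 sm0l big1 ?add0r ?scaleNr //.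
by move=> i _; rewrite !pd1 !sm0l addr0.
Qed.

Lemma ko_xi i z : ko (xo i) z = - (dx i z + xo i ** th z).
Proof.
rewrite koE sg_xi eul_xi pdN th_xi oppr0 sm0l addr0.
rewrite (bigD1 i) //= big1 => [|j /negPf ne].
  by rewrite pdN dxi_xi eqxx scale1r dx_xi sm0l smNl sm1l smDl smNl smZl;
    coef_ring.
by rewrite pdN dxi_xi ne scale0r oppr0 dx_xi !sm0l addr0.
Qed.

Lemma ko_x i z : ko (xe i) z = dxi i z - xe i ** th z.
Proof.
rewrite koE sg_x eul_x th_x sm0l addr0.
rewrite (bigD1 i) //= big1 => [|j /negPf ne].
  by rewrite dxi_x dx_x // eqxx scale1r sm0l sm1l smDl smNl smZl; coef_ring.
by rewrite dxi_x dx_x // ne scale0r !sm0l addr0.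
Qed.

Lemma ko_xxi i z : ko (xe i ** xo i) z = - wt i z.
Proof.
rewrite koE eul_mul // eul_x eul_xi sgM sg_x sg_xi smNr pdN th_mul th_x th_xi.
rewrite sm0l sm0r addr0 oppr0 sm0l addr0.
rewrite (bigD1 i) //= big1 => [|j /negPf ne].
  rewrite pdN dxi_mul dx_mul // dxi_x dxi_xi dx_x // dx_xi eqxx scale1r sm0l
    add0r.
  rewrite sg_x sm1r sm1l sm0r addr0 smNl /wt.
  by rewrite !(smDl, smNl, smZl) sm0l; coef_ring.
rewrite pdN dxi_mul dx_mul // dxi_x dxi_xi dx_x // dx_xi ne !scale0r !sm0l
  !sm0r.
by rewrite !addr0 oppr0 !sm0l addr0.
Qed.

Lemma ko_tau z : ko tau z = - D z - 2%:R *: (tau ** th z).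
Proof.
rewrite koE sg_tau eul_tau pdN th_tau big1 => [|i _].
  by rewrite smNl sm1l !sub0r smNl smZl; coef_ring.
by rewrite pdN dxi_tau dx_tau oppr0 !sm0l addr0.
Qed.

Lemma koDl a b z : ko (a + b) z = ko a z + ko b z.
Proof. by rewrite -!DKO_ko linearD add_lfunE. Qed.
Lemma koZl (k : F) a z : ko (k *: a) z = k *: ko a z.
Proof. by rewrite -!DKO_ko linearZ scale_lfunE. Qed.

(** * Elements of low degree in the image and their action *)

Section Generation.

Variable c : F.
Notation W := (koimg c).

Lemma koimg_th0 y : th y = 0 -> bv y \in W.
Proof.
move=> ty; apply/koimgP; exists y; last by rewrite lapE ty eul0 scaler0 subr0
  addr0.
(* As th y = 0, y is the derivative th (tau y), so its integral is 0. *)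
move=> _; have := berezin_pd (plast n) (tau ** y).
by rewrite th_mul ty th_tau sm0r sm1l addr0.
Qed.

Lemma bv_xi_mul i y : bv (xo i ** y) = dx i y - xo i ** bv y.
Proof.
rewrite bv_mul // sg_xi smNl bvE big1 => [|j _]; last first.
  by rewrite dxi_xi; case: eqP => _; rewrite ?scale1r ?scale0r ?pd1 ?pd0.
rewrite sm0l add0r addrC (bigD1 i) //= big1 => [|j /negPf ne].
  by rewrite dxi_xi dx_xi eqxx scale1r sm1l linear0 sm0l !addr0.
by rewrite dxi_xi dx_xi ne scale0r linear0 !sm0l addr0.
Qed.

Lemma bv_x_mul i y : bv (xe i ** y) = dxi i y + xe i ** bv y.
Proof.
rewrite bv_mul // sg_x bvE big1 => [|j _]; last by rewrite dxi_x pd0.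
rewrite sm0l add0r addrC (bigD1 i) //= big1 => [|j /negPf ne].
  by rewrite dxi_x dx_x // eqxx scale1r sm0l sg1 sm1l add0r addr0.
by rewrite dxi_x dx_x // ne scale0r sm0l linear0 sm0l addr0.
Qed.

Lemma bv_xi i : bv (xo i) = 0.
Proof.
rewrite bvE big1 // => j _; rewrite dxi_xi.
by case: eqP => _; rewrite ?scale1r ?scale0r ?pd1 ?pd0.
Qed.
Lemma bv_x i : bv (xe i) = 0.
Proof. by rewrite bvE big1 // => j _; rewrite dxi_x pd0. Qed.

Lemma bv_x_xi i : bv (xe i ** xo i) = unitO.
Proof. by rewrite bv_x_mul bv_xi sm0r addr0 dxi_xi eqxx scale1r. Qed.

Lemma th_x_xi i : th (xe i ** xo i) = 0.
Proof. by rewrite th_mul th_xi th_x sm0l sm0r addr0. Qed.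

Lemma x_xiC i : xo i ** xe i = xe i ** xo i.
Proof. by rewrite -{1}[xe i]sm1r mul_x sm1r. Qed.

Lemma unitO_koimg i : unitO \in W.
Proof. by rewrite -(bv_x_xi i); apply/koimg_th0/th_x_xi. Qed.

(** A second index j supplies the potential x_(j') x_j x_(i'); the next two lemmas use the same
    device. *)
Lemma xi_koimg i j : j != i -> xo i \in W.
Proof.
move=> /negPf ji.
have <- : bv (xo j ** (xe j ** xo i)) = xo i.
  rewrite bv_xi_mul dx_mul // dx_x // eqxx scale1r sm1l dx_xi sm0r addr0.
  by rewrite bv_x_mul dxi_xi ji scale0r bv_xi !(sm0r, addr0) subr0.
by apply: koimg_th0; rewrite !th_mul !th_xi th_x !sm0l !(sm0r, addr0).
Qed.

Lemma x_koimg i j : j != i -> xe i \in W.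
Proof.
move=> /negPf ji.
have <- : bv (xo j ** (xe j ** xe i)) = xe i.
  rewrite bv_xi_mul dx_mul // !dx_x // eqxx scale1r sm1l ji scale0r sm0r addr0.
  by rewrite bv_x_mul dxi_x bv_x !(sm0r, addr0) subr0.
by apply: koimg_th0; rewrite !th_mul !th_xi !th_x !sm0l !(sm0r, addr0).
Qed.

Lemma xxi_koimg i j : j != i -> xe i ** xo i - xe j ** xo j \in W.
Proof.
move=> /negPf ji.
have <- : bv (xo j ** (xe j ** (xe i ** xo i))) = xe i ** xo i - xe j ** xo j.
  rewrite bv_xi_mul !dx_mul // !dx_x // dx_xi eqxx scale1r sm1l ji scale0r sm0l.
  rewrite !(sm0r, addr0) bv_x_mul bv_x_xi sm1r dxi_mul dxi_x dxi_xi ji scale0r.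
  by rewrite sm0l sm0r !add0r x_xiC.
by apply: koimg_th0; rewrite !th_mul !th_xi !th_x !sm0l !(sm0r, addr0).
Qed.

Lemma tau_koimg i : c + 1 != 0 -> tau + c *: (xe i ** xo i) \in W.
Proof.
move=> c1; rewrite -[_ + _]opprK memvN; apply/koimgP.
exists (tau ** (xe i ** xo i)); first by move/eqP; rewrite (negPf c1).
rewrite lapE bv_mul // bv_x_xi sm1r sg_tau big1 => [|j _]; last first.
  by rewrite dxi_tau dx_tau linear0 !sm0l addr0.
have -> : bv tau = 0 by rewrite bvE big1 // => j _; rewrite dxi_tau pd0.
rewrite th_mul th_tau sm1l th_x_xi sm0r !addr0 eul_mul // eul_x eul_xi sm0l.
by coef_ring.
Qed.

Lemma par_x i : has_parity false (xe i).
Proof. by rewrite xv.unlock; apply: hom_xvar_even. Qed.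
Lemma par_xi i : has_parity true (xo i).
Proof. by rewrite xv.unlock; apply: hom_xvar_odd. Qed.
Lemma par_tau : has_parity true tau.
Proof. by rewrite xv.unlock; apply: hom_xvar_odd. Qed.

(** Carries the adjoint action of a on W over to potentials. Of the 4 s, half comes from moving
    [ko a] past [lap (c + 2)] and half from the last term in [kobrE]. The condition [d || (s == 0)]
    records that th of an even function is odd, so not a nonzero constant. *)
Lemma kobr_lap d a s z : has_parity d a -> a \in W ->
    th a = s *: unitO -> d || (s == 0) ->
  kobr c a (lap (c + 2%:R) z) =
    lap (c + 2%:R) (- (-1) ^+ d *: ko a z + (4%:R * s) *: z).
Proof.
move=> ha /koimg_ker ka ta ds.
have kz : lap c (lap (c + 2%:R) z) = 0.
  by rewrite lap_lap // (_ : _ - _ = 0) ?scale0r //; ring.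
rewrite (kobrE ha ka kz) ta smZl sm1l.
have e1 := ko_lap_ker ha ka z.
have e2 := ko_lap_pred_ker ha ka z.
move/(canRL (addrK _)): e1 => e1; move/(canRL (addrK _)): e2 => e2.
(* [lap] is affine in its parameter, so its value at c + 2 is extrapolated from those at c and c -
   2, where the commutation with [ko a] is known. *)
have eQ y : lap (c + 2%:R) y = 2%:R *: lap c y - lap (c - 2%:R) y.
  by rewrite lap_pred (lap_shift _ c); coef_ring.
have koDr x y : ko a (x + y) = ko a x + ko a y.
  by rewrite -!DKO_ko linearD.
have koZr (k : F) y : ko a (k *: y) = k *: ko a y.
  by rewrite -!DKO_ko linearZ.
have koNr y : ko a (- y) = - ko a y by rewrite -scaleN1r koZr scaleN1r.
rewrite {1}eQ koDr koNr koZr e1 e2 ta !smZl !sm1l lapZ.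
rewrite lapD !lapZ !eQ.
by case: d ha ds {e1 e2} => /= _ => [_|/eqP ->]; rewrite ?expr0 ?expr1;
  coef_ring.
Qed.

Hypothesis n_gt1 : (1 < n)%N.

Lemma other_index i : exists j, j != i.
Proof.
case: (eqVneq i (Ordinal n_gt1)) => [->|ne]; last by exists (Ordinal n_gt1);
  rewrite eq_sym.
by exists (Ordinal (ltnW n_gt1)).
Qed.

(** * Potentials reached by brackets *)

Section Span.

Variable B : {vspace O}.
Hypothesis kobr_B : forall a b, a \in W -> b \in W -> kobr c a b \in B.

(** Here B is any subspace containing the brackets of elements of W. The reached functions form a
    subspace, shown below to contain every potential. *)
Definition reached z := lap (c + 2%:R) z \in B.
Definition potential z := c + 1 = 0 -> berezin z = 0.

Lemma reachedD y z : reached y -> reached z -> reached (y + z).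
Proof. by rewrite /reached lapD; apply: memvD. Qed.
Lemma reachedZ (k : F) z : reached z -> reached (k *: z).
Proof. by rewrite /reached lapZ; apply: memvZ. Qed.
Lemma reachedB y z : reached y -> reached z -> reached (y - z).
Proof. by rewrite /reached lapB; apply: memvB. Qed.
Lemma reachedZK (k : F) z : k != 0 -> reached (k *: z) -> reached z.
Proof. by move=> k0 /(reachedZ k^-1); rewrite scalerA mulVf // scale1r. Qed.

Lemma reached_ko d a s z : has_parity d a -> a \in W -> th a = s *: unitO ->
  d || (s == 0) -> potential z -> reached (- (-1) ^+ d *: ko a z + (4%:R * s)
    *: z).
Proof.
move=> ha wa ta ds hz; rewrite /reached -(kobr_lap z ha wa ta ds).
by apply: kobr_B => //; apply/koimgP; exists z.
Qed.

Lemma reached_ko0 d a z : has_parity d a -> a \in W -> th a = 0 ->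
  potential z -> reached (ko a z).
Proof.
move=> ha wa ta hz; have := @reached_ko d a 0 z ha wa.
rewrite ta scale0r eqxx orbT mulr0 scale0r addr0 => /(_ erefl isT hz).
by apply: reachedZK; rewrite oppr_eq0 signr_eq0.
Qed.

Lemma potential_pd r z : potential (pd r z).
Proof. by move=> _; apply: berezin_pd. Qed.

Lemma reached_dx_xi i z : potential z -> reached (dx i z + xo i ** th z).
Proof.
move=> hz; have [j ji] := other_index i.
have := reached_ko0 (par_xi i) (xi_koimg ji) (th_xi _) hz.
by rewrite ko_xi -scaleN1r; apply: reachedZK; rewrite oppr_eq0 oner_eq0.
Qed.

Lemma reached_dxi_x i z : potential z -> reached (dxi i z - xe i ** th z).
Proof.
move=> hz; have [j ji] := other_index i.
by have := reached_ko0 (par_x i) (x_koimg ji) (th_x _) hz; rewrite ko_x.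
Qed.

Lemma reached_wt i j z : potential z -> reached (wt i z - wt j z).
Proof.
move=> hz; case: (eqVneq j i) => [->|ji].
  by rewrite subrr /reached linear0 mem0v.
have par k : has_parity true (xe k ** xo k) by exact: par_mul (par_x k) (par_xi
  k).
have := reached_ko0 (homB (par i) (par j)) (xxi_koimg ji) _ hz.
rewrite pdB !th_x_xi subrr => /(_ erefl).
have e : ko (xe i ** xo i - xe j ** xo j) z = -1 *: (wt i z - wt j z).
  by rewrite -[- (xe j ** _)]scaleN1r koDl koZl !ko_xxi; coef_ring.
by rewrite e; apply: reachedZK; rewrite oppr_eq0 oner_eq0.
Qed.

Lemma th_wt i z : th (wt i z) = wt i (th z).
Proof.
rewrite /wt pdB !th_mul th_x th_xi sg_x sg_xi !sm0l !add0r th_dx th_dxi.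
by rewrite smNl smNr opprK.
Qed.

Lemma reached_th_potential z : potential z -> reached (th z).
Proof.
move=> hz; have := reached_ko0 (hom_one _ _ _) (unitO_koimg (Ordinal n_gt1))
  (pd1 _) hz.
by rewrite ko1; apply: reachedZK; rewrite oppr_eq0 (two_neq0 p_char).
Qed.

(* The monomial T of highest degree need not be a potential: th T is obtained  *)
(* by comparing the two identities given by dx i T and dxi i T.                *)
Lemma reached_th z : reached (th z).
Proof.
pose T := bas top; have i : 'I_n := Ordinal n_gt1.
have hT : reached (th T).
  have := reachedB (reached_dx_xi i (potential_pd (oddvar i) T))
                   (reached_dxi_x i (potential_pd (inl i) T)).
  rewrite (_ : _ - _ = wt i (th T)); last first.
    by rewrite dxi_dx th_dx th_dxi smNr /wt; coef_ring.
  rewrite -th_wt wt_bas expo_top inE height_opp1 pdZ; apply: reachedZK.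
  by rewrite -opprD oppr_eq0 (two_neq0 p_char).
have -> : z = (z - berezin z *: T) + berezin z *: T by rewrite subrK.
rewrite pdD pdZ; apply: reachedD (reachedZ _ hT);
  apply: reached_th_potential => _.
by rewrite berezinB berezinZ /berezin coef_bas eqxx mulr1 subrr.
Qed.

Lemma reached_ker_th z : th z = 0 -> reached z.
Proof.
move=> tz; have <- : th (tau ** z) = z; last exact: reached_th.
by rewrite th_mul th_tau sm1l tz sm0r addr0.
Qed.

Lemma reached_dx i z : potential z -> reached (dx i z).
Proof.
move=> /(reached_dx_xi i) h; rewrite -[dx i z](addrK (xo i ** th z)).
apply: reachedB h (reached_ker_th _).
by rewrite th_mul th_xi th_sq // sm0l sm0r addr0.
Qed.

Lemma reached_dxi i z : potential z -> reached (dxi i z).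
Proof.
move=> /(reached_dxi_x i) h; rewrite -[dxi i z](subrK (xe i ** th z)).
apply: reachedD h (reached_ker_th _).
by rewrite th_mul th_x th_sq // sm0l sm0r addr0.
Qed.

Lemma potential_bas u : u != top -> potential (bas u).
Proof. by move=> /negPf ne _; rewrite /berezin coef_bas eq_sym ne. Qed.

Lemma reached_weight i j u : u != top ->
  (expo u i)%:R - (widen i \in u.2)%:R !=
  (expo u j)%:R - (widen j \in u.2)%:R :> F -> reached (bas u).
Proof.
move=> /potential_bas hu ne; have := reached_wt i j hu;
  rewrite !wt_bas -scalerBl.
by apply: reachedZK; rewrite subr_eq0.
Qed.

(** A monomial without x_(2n+1) is killed by th, hence reached. Otherwise it is, up to sign, a
    derivative of a monomial v: raise an exponent below its height or, if there is none, insert a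
    missing odd variable. If v is the top monomial, which need not be a potential, the weights of u
    at i and at another index j differ by 1 up to sign, and [reached_weight] applies. *)
Lemma reached_bas u : u != top -> reached (bas u).
Proof.
move=> nu; have [tu|tu] := boolP (ord_max \in u.2); last first.
  apply: reached_ker_th; rewrite pd.unlock partial_xmon_odd (negPf tu) //.
have [/existsP[i lt_i]|] := boolP [exists i, (expo u i < height i)%N].
  have [j ji] := other_index i.
  pose v := mkmono p t (fun k => expo u k + (k == i))%N u.2.
  have ev k : expo v k = (expo u k + (k == i))%N.
    rewrite expo_mkmono //; case: eqP => [->|_]; first by rewrite addn1.
    by rewrite addn0 expo_le.
  have edx : dx i (bas v) = bas u.
    rewrite pd.unlock partial_xmon_even ?expo_le // ev eqxx addn1 /=.
    by apply: eq_xmon => k; rewrite ev addnK.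
  have [vt|/potential_bas] := eqVneq v top; last by rewrite -edx;
    apply: reached_dx.
  have u2 : u.2 = setT by rewrite -[LHS]/(v.2) vt.
  have := ev j; have := ev i; rewrite vt !expo_top eqxx (negPf ji) addn0 =>
    ei ej.
  have ui : (expo u i)%:R = - 2%:R :> F.
    have := height_opp1 i; rewrite ei natrD => /(canRL (addrK _)) ->.
    by rewrite -opprD.
  apply: (@reached_weight i j) => //; rewrite u2 !inE -ej height_opp1 ui.
  by rewrite -subr_eq0 (_ : _ - _ = - 1) ?oppr_eq0 ?oner_eq0 //=; ring.
rewrite negb_exists => /forallP le_h.
have eh k : expo u k = height k.
  by apply/eqP; rewrite eqn_leq expo_le leqNgt le_h.
have [i iu] : exists i, widen i \notin u.2.
  have /existsP[s su] : [exists s, s \notin u.2].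
    rewrite -negb_forall; apply: contra nu => /forallP h; apply/eqP.
    apply: eq_mono => [k|]; first by rewrite eh expo_top.
    by apply/setP => s; rewrite h inE.
  have ltsn : (s < n)%N.
    rewrite ltn_neqAle -ltnS ltn_ord andbT; apply: contraNneq su => e.
    by have -> : s = ord_max by apply: val_inj.
  by exists (Ordinal ltsn); have -> : widen (Ordinal ltsn) = s by apply:
    val_inj.
have [j ji] := other_index i.
pose v : mono := (u.1, widen i |: u.2).
have ev : dxi i (bas v) = (-1) ^+ inversions [set widen i] u.2 *: bas u.
  rewrite pd.unlock partial_xmon_odd setU11 setU1K //.
have [vt|/potential_bas] := eqVneq v top; last first.
  move/(reached_dxi i); rewrite ev; apply: reachedZK; by rewrite signr_eq0.
have ju : widen j \in u.2.
  have : widen j \in v.2 by rewrite vt inE.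
  by rewrite !inE => /predU1P[[/val_inj e]|//]; rewrite e eqxx in ji.
apply: (@reached_weight i j) => //; rewrite (negPf iu) ju !eh !height_opp1.
by rewrite -subr_eq0 (_ : _ - _ = 1) ?oner_eq0 //=; ring.
Qed.

(** The top monomial has degree 0 in F and all its weights are -2, so D_KO of tau + c x_i x_(i')
    acts on it by -2 + 2 c; [kobr_lap] adds 4, which makes 2 (c + 1). *)
Lemma reached_top : c + 1 != 0 -> reached (bas top).
Proof.
move=> c1; pose i : 'I_n := Ordinal n_gt1.
have par : has_parity true (tau + c *: (xe i ** xo i)).
  exact: homD par_tau (homZ _ (par_mul (par_x i) (par_xi i))).
have ta : th (tau + c *: (xe i ** xo i)) = 1 *: unitO.
  by rewrite pdD pdZ th_tau th_x_xi scaler0 addr0 scale1r.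
have hz : potential (bas top) by move/eqP; rewrite (negPf c1).
have := reached_ko par (tau_koimg i c1) ta isT hz.
rewrite koDl koZl ko_xxi ko_tau eul_bas wt_bas xi_dxi_bas !inE expo_top
  height_opp1.
have -> : (\sum_i (expo top i + (widen i \in top.2)))%N%:R = 0 :> F.
  rewrite natr_sum big1 // => k _; rewrite inE natrD expo_top height_opp1.
  exact: addNr.
rewrite /= expr1 (_ : _ + _ = (2%:R * (c + 1)) *: bas top); last by coef_ring.
by apply: reachedZK; rewrite mulf_neq0 // (two_neq0 p_char).
Qed.

Lemma koimg_sub : (W <= B)%VS.
Proof.
apply/subvP => _ /koimgP[z hz ->]; rewrite -/(reached z) [z]basis_sum.
apply: (big_ind reached) => [|y y'|u _].
- by rewrite /reached linear0 mem0v.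
- exact: reachedD.
have [->|nu] := eqVneq u top; last exact/reachedZ/reached_bas.
have [/eqP c1|c1] := boolP (c + 1 == 0); last exact/reachedZ/reached_top.
by have := hz c1; rewrite /berezin => ->; rewrite scale0r /reached linear0
  mem0v.
Qed.

End Span.

End Generation.

(** * The rank of lap *)

(* The cohomology of bv is spanned by the monomials with, for each i, either   *)
(* xi_i and no x_i, or the highest power of x_i and no xi_i.  On the others, a *)
(* homotopy is obtained by integrating at one index where this fails, chosen   *)
(* as a function of the set of these indices only.                             *)
Definition noncoh u i : bool :=
  if widen i \in u.2 then expo u i != 0%N else expo u i != height i.
Definition defect u : option 'I_n := [pick i | noncoh u i].

Lemma defect_some u i : defect u = Some i -> noncoh u i.
Proof. by rewrite /defect; case: pickP => // j nj [<-]. Qed.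

Lemma defect_none u i : defect u = None -> noncoh u i = false.
Proof. by rewrite /defect; case: pickP. Qed.

Lemma eq_defect u v : noncoh u =1 noncoh v -> defect u = defect v.
Proof. exact: eq_pick. Qed.

(** Integration in x_i: on divided powers it has no denominators, and the highest power goes to 0 by
    overflow. *)
Definition raise i : 'End(O) :=
  lext (fun u => xmon (fun j => expo u j + (j == i))%N u.2).

Lemma raise_xmon i g (S : {set 'I_n.+1}) :
  raise i (xmon g S) = xmon (fun j => g j + (j == i))%N S.
Proof.
case: xmonP => [u eu <-|j lt_j]; last first.
  rewrite linear0 (xmon_overflow F _ (i := j)) //.
  exact: leq_trans lt_j (leq_addr _ _).
by rewrite lext_bas; apply: eq_xmon => j; rewrite eu.
Qed.

Lemma raise_dxi i s z : raise i (pd (inr s) z) = pd (inr s) (raise i z).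
Proof.
rewrite pd.unlock.
have /lfunP/(_ z) : (raise i \o partial F p t (inr s) = partial F p t (inr s)
  \o raise i)%VF;
  last by rewrite !comp_lfunE.
apply: eq_lfun_basis => u; rewrite !comp_lfunE raise_xmon !partial_xmon_odd.
by case: ifP => _; rewrite ?linear0 // linearZ /= raise_xmon.
Qed.

Lemma raise_dx i j z : j != i -> raise i (dx j z) = dx j (raise i z).
Proof.
move=> /negPf ji; rewrite pd.unlock.
have /lfunP/(_ z) : (raise i \o partial F p t (inl j) = partial F p t (inl j)
  \o raise i)%VF;
  last by rewrite !comp_lfunE.
apply: eq_lfun_basis => u; rewrite !comp_lfunE raise_xmon !partial_xmon_even
  ?ji ?addn0 ?expo_le //.
case: eqP => uj; rewrite ?linear0 // raise_xmon; apply: eq_xmon => k.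
by case: (eqVneq k j) => [->|_]; rewrite ?ji ?addn0 ?subn0.
Qed.

Lemma raise_dx_bas i u : raise i (dx i (bas u)) = (expo u i != 0%N)%:R *: bas u.
Proof.
rewrite pd.unlock partial_xmon_even ?expo_le //; case: eqP => ui.
  by rewrite linear0 scale0r.
rewrite raise_xmon scale1r; apply: eq_xmon => k; rewrite subnK //.
by case: eqP => // ->; rewrite lt0n; apply/eqP.
Qed.

Lemma dx_raise_bas i u : dx i (raise i (bas u)) = (expo u i != height i)%:R *:
  bas u.
Proof.
rewrite pd.unlock raise_xmon; have [ui|lt_ui] := eqVneq (expo u i) (height i).
  by rewrite (xmon_overflow F _ (i := i)) ?linear0 ?scale0r // eqxx addn1 ui.
rewrite partial_xmon_even eqxx addn1 ?ltn_neqAle ?lt_ui ?expo_le //= scale1r.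
by apply: eq_xmon => k; rewrite addnK.
Qed.

(** The contracting homotopy for the i-th summand of Delta; it anticommutes with the other
    summands. *)
Definition integ i z := xo i ** raise i z.

Lemma bv_term_integ_ne i k z : k != i ->
  dx k (dxi k (integ i z)) + integ i (dx k (dxi k z)) = 0.
Proof.
move=> ki; rewrite /integ dxi_mul dxi_xi (negPf ki) scale0r sm0l add0r sg_xi
  smNl.
rewrite pdN dx_mul // dx_xi sm0l add0r raise_dx // raise_dxi; exact: addNr.
Qed.

Lemma bv_term_integ i u :
  dx i (dxi i (integ i (bas u))) + integ i (dx i (dxi i (bas u))) =
  (noncoh u i)%:R *: bas u.
Proof.
rewrite /integ dxi_mul dxi_xi eqxx scale1r sm1l sg_xi smNl pdD pdN dx_mul //
  dx_xi.
rewrite sm0l add0r dx_raise_bas -!dxi_dx dx_raise_bas raise_dxi raise_dx_bas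
  !pdZ.
rewrite !smZr xi_dxi_bas /noncoh; case: (widen i \in u.2).
  by rewrite scale1r subrr add0r.
by rewrite scale0r !scaler0 oppr0 !addr0.
Qed.

Definition bvf : 'End(O) := linfun (@bv F p n t).
Lemma bvfE z : bvf z = bv z. Proof. exact: lfunE. Qed.
Definition thf : 'End(O) := linfun th.
Lemma thfE z : thf z = th z. Proof. exact: lfunE. Qed.

Definition htpy : 'End(O) :=
  lext (fun u => if defect u is Some i then integ i (bas u) else 0).
Definition harm : 'End(O) := lext (fun u => if defect u is None then bas u else
  0).

(** The operators below send a monomial to 0 or to a multiple of a monomial whose shape alone
    matters, so the scalar is not tracked. *)
Variant scaled_bas (P : mono -> Prop) : O -> Prop :=
  | ScaledBas0 : scaled_bas P 0
  | ScaledBas k v of P v : scaled_bas P (k *: bas v).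

Lemma scaled_xmon (P : mono -> Prop) k g S :
  (forall v, expo v =1 g -> v.2 = S -> P v) -> scaled_bas P (k *: xmon g S).
Proof.
move=> hP; case: xmonP => [v ev eS|j _]; last by rewrite scaler0; constructor.
by constructor; apply: hP.
Qed.

(** Where it is nonzero, the k-th summand of Delta trades x_(k') and a positive power of x_k for a
    power below the height, so k stays non-cohomological. Hence Delta preserves [defect], the index
    chosen for the homotopy. *)
Lemma bv_term_bas k u :
  scaled_bas (fun v => [/\ noncoh v =1 noncoh u & noncoh u k]) (dx k (dxi k
    (bas u))).
Proof.
rewrite pd.unlock partial_xmon_odd; case: ifP => ku; last first.
  by rewrite linear0; constructor.
rewrite linearZ /= partial_xmon_even ?expo_le //; case: eqP => uk.
  by rewrite scaler0; constructor.
apply: scaled_xmon => v ev eS; split; last by rewrite /noncoh ku; apply/eqP.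
move=> j; rewrite /noncoh eS ev !inE.
have -> : (widen j == widen k) = (j == k) by rewrite -!val_eqE.
case: eqP => [->|_] /=; last by rewrite subn0.
rewrite ku subn1; have := expo_le u k; move/eqP: uk.
by case: (expo u k) => // m _ lt_m; rewrite neq_ltn lt_m.
Qed.

Lemma th_bas u : scaled_bas
  (fun v => [/\ expo v =1 expo u, v.2 = u.2 :\ ord_max & ord_max \in u.2]) (th
    (bas u)).
Proof.
rewrite pd.unlock partial_xmon_odd; case: ifP => tu; last by constructor.
by apply: scaled_xmon => v ev eS; split.
Qed.

Lemma integ_bas i u : noncoh u i -> scaled_bas
  (fun v => [/\ noncoh v =1 noncoh u, widen i \in v.2 & widen i \notin u.2])
  (integ i (bas u)).
Proof.
move=> nu; rewrite /integ smul.unlock xv.unlock raise_xmon mul_xmon disjoints1.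
case: ifP => iu; last by constructor.
apply: scaled_xmon => v ev eS; split => //; last by rewrite eS !inE eqxx.
move=> j; rewrite /noncoh eS ev !inE.
have -> : (widen j == widen i) = (j == i) by rewrite -!val_eqE.
case: eqP => [->|_] /=; last by rewrite addn0.
by move: nu; rewrite /noncoh (negPf iu) addn1 => ->.
Qed.

Lemma htpy_bas u : htpy (bas u) = if defect u is Some i then integ i (bas u)
  else 0.
Proof. exact: lext_bas. Qed.
Lemma harm_bas u : harm (bas u) = if defect u is None then bas u else 0.
Proof. exact: lext_bas. Qed.

Fact integ_linear i : linear (integ i).
Proof. by move=> k y z; rewrite /integ !linearP. Qed.
HB.instance Definition _ i := GRing.isLinear.Build F O O _ (integ i)
  (integ_linear i).

(** On a monomial with defect i all terms of Delta keep that defect, so [integ i] serves throughout: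
    the i-th summand gives the identity and the others cancel. On a class monomial every summand of
    Delta vanishes. *)
Lemma htpy_bv z : bv (htpy z) + htpy (bv z) = z - harm z.
Proof.
have /lfunP/(_ z) : ((bvf \o htpy) + (htpy \o bvf) = \1 - harm)%VF;
  last by rewrite add_lfunE lfunBE id_lfunE !comp_lfunE !bvfE.
apply: eq_lfun_basis => u; rewrite add_lfunE lfunBE id_lfunE !comp_lfunE !bvfE.
rewrite harm_bas htpy_bas !bvE linear_sum -big_split /=.
case fu: (defect u) => [i|]; last first.
  rewrite subrr big1 // => k _; rewrite linear0 !pd0 add0r.
  by case: bv_term_bas => [|x v [_]]; rewrite ?linear0 // defect_none.
have e k : htpy (dx k (dxi k (bas u))) = integ i (dx k (dxi k (bas u))).
  case: bv_term_bas => [|x v [ev _]]; first by rewrite !linear0.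
  by rewrite !linearZ /= htpy_bas (eq_defect ev) fu.
rewrite subr0 (bigD1 i) //= e bv_term_integ (defect_some fu) scale1r big1
  ?addr0 //.
by move=> k ki; rewrite e bv_term_integ_ne.
Qed.

Lemma bv_harm z : bv (harm z) = 0.
Proof.
have /lfunP/(_ z) : (bvf \o harm)%VF = 0; last by rewrite zero_lfunE comp_lfunE
  bvfE.
apply: eq_lfun_basis => u; rewrite zero_lfunE comp_lfunE bvfE harm_bas.
case fu: (defect u); rewrite ?linear0 // bvE big1 // => k _.
by case: bv_term_bas => // x v [_]; rewrite defect_none.
Qed.

Lemma harm_bv z : harm (bv z) = 0.
Proof.
have /lfunP/(_ z) : (harm \o bvf)%VF = 0; last by rewrite zero_lfunE comp_lfunE
  bvfE.
apply: eq_lfun_basis => u; rewrite zero_lfunE comp_lfunE bvfE bvE linear_sum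
  big1 //= => k _.
case: bv_term_bas => [|x v [ev nk]]; rewrite ?linear0 // linearZ /= harm_bas
  (eq_defect ev).
by case fu: (defect u); [exact: scaler0 | rewrite defect_none in nk].
Qed.

Lemma noncoh_th u v : expo v =1 expo u -> v.2 = u.2 :\ ord_max ->
  noncoh v =1 noncoh u.
Proof.
move=> ev eS i; rewrite /noncoh ev eS !inE.
by rewrite -val_eqE /= ltn_eqF.
Qed.

Lemma th_htpy z : th (htpy z) = - htpy (th z).
Proof.
have /lfunP/(_ z) : (thf \o htpy)%VF = - (htpy \o thf)%VF;
  last by rewrite opp_lfunE !comp_lfunE !thfE.
apply: eq_lfun_basis => u; rewrite opp_lfunE !comp_lfunE !thfE /= htpy_bas.
case fu: (defect u) => [i|].
  have -> : htpy (th (bas u)) = integ i (th (bas u)).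
    case: th_bas => [|x v [ev eS _]]; first by rewrite !linear0.
    by rewrite !linearZ /= htpy_bas (eq_defect (noncoh_th ev eS)) fu.
  by rewrite /integ th_mul th_xi sm0l add0r sg_xi smNl raise_dxi.
rewrite pd0; case: th_bas => [|x v [ev eS _]]; first by rewrite linear0 oppr0.
by rewrite linearZ /= htpy_bas (eq_defect (noncoh_th ev eS)) fu scaler0 oppr0.
Qed.

Definition spanP (P : pred mono) : {vspace O} := <<[seq bas u | u <- enum
  P]>>%VS.
Definition restr (P : pred mono) : 'End(O) := lext (fun u =>
  if P u then bas u else 0).

Lemma restr_bas P u : restr P (bas u) = if P u then bas u else 0.
Proof. exact: lext_bas. Qed.

Lemma spanP_sub (P : pred mono) (U : {vspace O}) :
  (forall u, P u -> bas u \in U) -> (spanP P <= U)%VS.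
Proof.
by move=> h; apply/span_subvP => _ /mapP[u + ->]; rewrite mem_enum => /h.
Qed.

Lemma mem_spanP (P : pred mono) u : P u -> bas u \in spanP P.
Proof. by move=> Pu; apply/memv_span/map_f; rewrite mem_enum. Qed.

Lemma spanPP (P : pred mono) z :
  reflect (forall u, ~~ P u -> coef z u = 0) (z \in spanP P).
Proof.
apply: (iffP idP) => [zP u nPu|h]; last first.
  rewrite [z]basis_sum; apply: memv_suml => u _.
  by have [/mem_spanP/memvZ//|/h ->] := boolP (P u); rewrite scale0r mem0v.
pose f : 'Hom(O, F^o) := linfun (HB.pack_for {linear O -> F^o} (fun a : O =>
  coef a u : F^o)
  (GRing.isLinear.Build F O F^o _ (fun a : O => coef a u : F^o)
    (fun k a b => etrans (ocoefD _ _ _) (congr1 (fun x =>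
      x + coef b u) (ocoefZ _ _ _))))).
have : (spanP P <= lker f)%VS.
  apply: spanP_sub => v Pv; rewrite memv_ker lfunE /= coef_bas.
  by have /negPf -> : u != v by apply: contraNneq nPu => ->.
by move/subvP/(_ _ zP); rewrite memv_ker lfunE => /eqP.
Qed.

Lemma dim_O : \dim {: O} = #|{: mono}|.
Proof. by rewrite dimvf; apply: muln1. Qed.

Lemma dim_spanP (P : pred mono) : \dim (spanP P) = #|P|.
Proof.
have le Q : (\dim (spanP Q) <= #|Q|)%N.
  by rewrite (leq_trans (dim_span _)) // size_map -cardE.
apply/eqP; rewrite eqn_leq le /= -(leq_add2r #|predC P|) cardC -dim_O.
apply: leq_trans (leq_add (leqnn _) (le (predC P))).
apply: leq_trans (dimv_add_leqif _ _); apply: dimvS; apply/subvP => z _.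
rewrite [z]basis_sum; apply: memv_suml => u _; apply: memvZ.
have [Pu|nPu] := boolP (P u).
  by apply: (subvP (addvSl _ _)); apply: mem_spanP.
by apply: (subvP (addvSr _ _)); apply: mem_spanP.
Qed.

(** The homotopy maps the span of B into that of A; Delta followed by projection onto B goes back. C
    is the set of class monomials. *)
Definition inA u : bool := if defect u is Some i then widen i \in u.2 else
  false.
Definition inB u : bool := if defect u is Some i then widen i \notin u.2 else
  false.
Definition inC u : bool := defect u == None.

Lemma card_ABC : (#|inA| + #|inB| + #|inC| = #|{: mono}|)%N.
Proof.
rewrite -!sum1_card [X in (X + _ + _)%N]big_mkcond [X in (_ + X +
  _)%N]big_mkcond /=.
rewrite [X in (_ + X)%N]big_mkcond -!big_split /=; apply: eq_bigr => u _.
rewrite /in_mem /= /inA /inB /inC; case: (defect u) => [i|] //=.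
by case: (widen i \in u.2).
Qed.

Lemma htpy_A z : htpy z \in spanP inA.
Proof.
rewrite [z]basis_sum linear_sum; apply: memv_suml => u _;
  rewrite linearZ /= memvZ //.
rewrite htpy_bas; case fu: (defect u) => [i|]; last exact: mem0v.
case: (integ_bas (defect_some fu)) => [|x v [ev iv _]]; first exact: mem0v.
by apply/memvZ/mem_spanP; rewrite /inA (eq_defect ev) fu.
Qed.

Lemma htpy_eq0 z : (forall u, inB u -> coef z u = 0) -> htpy z = 0.
Proof.
move=> h; rewrite [z]basis_sum linear_sum big1 // => u _;
  rewrite linearZ /= htpy_bas.
case fu: (defect u) => [i|]; last exact: scaler0.
have [iu|iu] := boolP (widen i \in u.2); last first.
  by rewrite h ?scale0r // /inB fu.
case: (integ_bas (defect_some fu)) => [|x v [_ _]]; first exact: scaler0.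
by rewrite iu.
Qed.

Lemma harm_eq0 z : (forall u, inC u -> coef z u = 0) -> harm z = 0.
Proof.
move=> h; rewrite [z]basis_sum linear_sum big1 // => u _;
  rewrite linearZ /= harm_bas.
case fu: (defect u) => [i|]; first exact: scaler0.
by rewrite h ?scale0r // /inC fu.
Qed.

Lemma coef_restr (P : pred mono) z u : coef (restr P z) u = if P u then coef z
  u else 0.
Proof.
rewrite {1}[z]basis_sum linear_sum ocoef_sum (bigD1 u) //= big1 =>
  [|v /negPf ne].
  rewrite addr0 linearZ /= restr_bas; case: ifP => _;
    rewrite ocoefZ ?ocoef0 ?mulr0 //.
  by rewrite coef_bas eqxx mulr1.
rewrite linearZ /= restr_bas; case: ifP => _; rewrite ocoefZ ?ocoef0 ?mulr0 //.
by rewrite coef_bas eq_sym ne mulr0.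
Qed.

Lemma ABC_cases u : [/\ inA u -> ~~ inB u, inA u -> ~~ inC u & inB u ->
  ~~ inC u].
Proof. by rewrite /inA /inB /inC; case: (defect u) => [i|] //;
  rewrite negbK. Qed.

(** There are injections both ways by [htpy_bv]. On the span of A, [htpy] and [harm] vanish, so z =
    htpy (bv z) depends only on the B-part of bv z. On the span of B, htpy z = 0 would give z = htpy
    (bv z), an element of the span of A. *)
Lemma card_A_B : #|inA| = #|inB|.
Proof.
apply/eqP; rewrite eqn_leq; apply/andP; split; rewrite -!dim_spanP.
  have inj : (spanP inA :&: lker (restr inB \o bvf) = 0)%VS.
    apply/eqP; rewrite -subv0; apply/subvP => z; rewrite memv_cap memv_ker =>
      /andP[zA].
    rewrite comp_lfunE bvfE memv0 => /eqP z0; apply/eqP; have := htpy_bv z.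
    have hz : htpy z = 0.
      by apply: htpy_eq0 => u uB; move/spanPP: zA; apply; apply: contraL uB;
        case: (ABC_cases u).
    have az : harm z = 0.
      by apply: harm_eq0 => u uC; move/spanPP: zA; apply; apply: contraL uC;
        case: (ABC_cases u).
    rewrite hz az linear0 add0r subr0 => <-; apply: htpy_eq0 => u uB.
    by have := congr1 (fun y => coef y u) z0; rewrite coef_restr uB ocoef0.
  rewrite -(limg_dim_eq inj); apply: dimvS; apply/subvP => _ /memv_imgP[y _ ->].
  by rewrite comp_lfunE; apply/spanPP => u uB; rewrite coef_restr (negPf uB).
have inj : (spanP inB :&: lker htpy = 0)%VS.
  apply/eqP; rewrite -subv0; apply/subvP => z; rewrite memv_cap memv_ker =>
    /andP[zB].
  rewrite memv0 => /eqP z0; apply/eqP; have := htpy_bv z.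
  have az : harm z = 0.
    by apply: harm_eq0 => u uC; move/spanPP: zB; apply; apply: contraL uC;
      case: (ABC_cases u).
  rewrite z0 az linear0 add0r subr0 => e; apply: ocoefP => u; rewrite ocoef0.
  have [uB|/(spanPP _ _ zB)//] := boolP (inB u).
  rewrite -e; have /spanPP := htpy_A (bv z); apply.
  by apply: contraL uB; case: (ABC_cases u).
rewrite -(limg_dim_eq inj); apply: dimvS; apply/subvP => _ /memv_imgP[y _ ->].
exact: htpy_A.
Qed.

Section Rank.

Variable k : F.

Definition deg u : F := (\sum_i (expo u i + (widen i \in u.2)))%N%:R.
(** Monomials spanning a complement of the kernel of [lap k]: Delta is injective on the span of A,
    and on a class monomial [lap k] is deg - k times the last derivative. *)
Definition rk_set u : bool := inA u || [&& inC u, ord_max \in u.2 & deg u != k].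

Lemma deg_th u v : expo v =1 expo u -> v.2 = u.2 :\ ord_max -> deg v = deg u.
Proof.
move=> ev eS; congr (_%:R); apply: eq_bigr => i _; rewrite ev eS !inE.
by rewrite -val_eqE /= ltn_eqF.
Qed.

Lemma lap_bas0 z : th z = 0 -> lap k z = bv z.
Proof. by move=> tz; rewrite lapE tz eul0 scaler0 subr0 addr0. Qed.

Lemma eul_harm z : harm (D z) = D (harm z).
Proof.
pose Df : 'End(O) := linfun D.
have DfE y : Df y = D y by exact: lfunE.
have /lfunP/(_ z) : (harm \o Df)%VF = (Df \o harm)%VF;
  last by rewrite !comp_lfunE !DfE.
apply: eq_lfun_basis => u; rewrite !comp_lfunE !DfE eul_bas // harm_bas linearZ
  /= harm_bas.
by case: (defect u) => [i|]; rewrite ?eul0 ?scaler0 ?eul_bas.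
Qed.

Lemma coef_eul z u : coef (D z) u = deg u * coef z u.
Proof.
rewrite {1}[z]basis_sum linear_sum ocoef_sum (bigD1 u) //= big1 =>
  [|v /negPf ne].
  by rewrite addr0 eulZ eul_bas // !ocoefZ coef_bas eqxx mulr1 mulrC.
by rewrite eulZ eul_bas // !ocoefZ coef_bas eq_sym ne !mulr0.
Qed.

Lemma coef_tau_th z u : coef (tau ** th z) u = if ord_max \in u.2 then coef z u
  else 0.
Proof.
rewrite {1}[z]basis_sum !linear_sum ocoef_sum (bigD1 u) //= big1 =>
  [|v /negPf ne].
  rewrite addr0 !linearZ /= xi_dxi_bas !ocoefZ coef_bas eqxx mulr1.
  by case: ifP; rewrite ?mulr1 ?mulr0.
by rewrite !linearZ /= xi_dxi_bas !ocoefZ coef_bas eq_sym ne !mulr0.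
Qed.

(** Having no B-part, z satisfies htpy z = 0; moreover th z is closed, hence harmonic. Applying
    [harm] to lap k z = 0 leaves (D - k) th z = 0, and no class of degree k occurs in th z, so th z
    = 0. Then z is a sum of classes without x_(2n+1), which [rk_set] excludes. *)
Lemma lap_inj z : z \in spanP rk_set -> lap k z = 0 -> z = 0.
Proof.
move=> zS z0.
have hz : htpy z = 0.
  apply: htpy_eq0 => u uB; move/spanPP: zS; apply; apply: contraL uB.
  by case: (ABC_cases u) => h1 h2 h3 /orP[/h1//|/and3P[uC _ _]];
    apply: contraL uC.
have ht : htpy (th z) = 0 by rewrite -[LHS]opprK -th_htpy hz pd0 oppr0.
have bt : bv (th z) = 0.
  have := congr1 th z0; rewrite th_lap // pd0 lapE th_sq // eul0 scaler0 subr0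
    addr0.
  by move/eqP; rewrite oppr_eq0 => /eqP.
have yh : th z = harm (th z).
  by have := htpy_bv (th z); rewrite ht bt !linear0 addr0 => /esym/eqP;
    rewrite subr_eq0 => /eqP.
have tz : th z = 0.
  have := congr1 harm z0; rewrite lapE linearB linearD /= linearZ /= harm_bv
    add0r linear0.
  rewrite eul_harm -yh => e; apply: ocoefP => u; rewrite ocoef0.
  have /eqP := congr1 (fun y => coef y u) e; rewrite ocoefB coef_eul ocoefZ
    ocoef0 -mulrBl.
  rewrite mulf_eq0 subr_eq0 => /orP[/eqP du|/eqP//].
  have /spanPP : th z \in spanP (fun v => (defect v != None) || (deg v != k)).
    rewrite [z]basis_sum linear_sum; apply: memv_suml => v _;
      rewrite linearZ /=.
    have [vS|/(spanPP _ _ zS) ->] := boolP (rk_set v);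
      last by rewrite scale0r mem0v.
    apply: memvZ; case: th_bas => [|x w [ew eS _]]; first exact: mem0v.
    apply/memvZ/mem_spanP; rewrite (eq_defect (noncoh_th ew eS)) (deg_th ew eS).
    case/orP: vS; first by rewrite /inA; case: (defect v).
    by case/and3P=> _ _ ->; rewrite orbT.
  have [fu|fu] := boolP (defect u == None); first by apply; rewrite fu du eqxx.
  move=> _; rewrite yh [th z]basis_sum linear_sum ocoef_sum big1 // => v _.
  rewrite linearZ /= harm_bas ocoefZ; case fv: (defect v);
    first by rewrite ocoef0 mulr0.
  by rewrite coef_bas (_ : u == v = false) ?mulr0 //; apply: contraNF fu =>
    /eqP ->; rewrite fv.
have zh : z = harm z.
  have := htpy_bv z; rewrite hz linear0 add0r -(lap_bas0 tz) z0 linear0.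
  by move/esym/eqP; rewrite subr_eq0 => /eqP.
apply: ocoefP => u; rewrite ocoef0.
have [tu|tu] := boolP (ord_max \in u.2).
  by have := coef_tau_th z u; rewrite tz tu sm0r ocoef0.
have [/orP[uA|/and3P[_]]|/(spanPP _ _ zS)//] := boolP (rk_set u);
  last by rewrite (negPf tu).
rewrite zh [z]basis_sum linear_sum ocoef_sum big1 // => v _.
rewrite linearZ /= harm_bas ocoefZ; case fv: (defect v);
  first by rewrite ocoef0 mulr0.
rewrite coef_bas (_ : u == v = false) ?mulr0 //.
by apply: contraTF uA => /eqP ->; rewrite /inA fv.
Qed.

Lemma lap_span z : lapf k z \in (lapf k @: spanP rk_set)%VS.
Proof.
have A_S y : lapf k (htpy y) \in (lapf k @: spanP rk_set)%VS.
  apply: memv_img; apply: (subvP _ _ (htpy_A y)); apply: spanP_sub => u uA.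
  by apply: mem_spanP; rewrite /rk_set uA.
have -> : z = bv (htpy z) + htpy (bv z) + harm z by rewrite htpy_bv subrK.
rewrite !linearD /= memvD ?memvD //.
  (* Chosen so that bv e = lap k (bv w). As th e = 0, [lap k] agrees with Delta on htpy (bv e), and
     Delta returns bv e there. *)
  set w := htpy z; pose e := (2%:R + k) *: th w - D (th w).
  have te : th e = 0 by rewrite pdB pdZ th_eul // th_sq // eul0 scaler0 subr0.
  suff -> : lapf k (bv w) = lapf k (htpy (bv e)) by exact: A_S.
  rewrite !lapfE [RHS]lap_bas0; last first.
    by rewrite th_htpy th_bv te [bv 0]linear0 oppr0 linear0 oppr0.
  have := congr1 (@bv F p n t) (htpy_bv e); rewrite bvD bvB bv_sq // bv_harm
    add0r subr0 => ->.
  rewrite lapE bv_sq // th_bv eulN bvB bvZ bv_eul //; coef_ring.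
(* A class monomial outside [rk_set] is killed by [lap k]: it lacks x_(2n+1), or its degree is k. *)
suff -> : lapf k (harm z) = lapf k (restr rk_set (harm z)).
  by apply: memv_img; apply/spanPP => u nu; rewrite coef_restr (negPf nu).
pose L := lapf k; have /lfunP/(_ z) : (L \o harm)%VF = (L \o (restr rk_set \o
  harm))%VF;
  last by rewrite !comp_lfunE.
apply: eq_lfun_basis => u; rewrite !comp_lfunE harm_bas.
case fu: (defect u) => [i|]; first by rewrite !linear0.
rewrite restr_bas /rk_set /inA /inC fu /=; case: ifP => // /negbT.
rewrite linear0 lapfE negb_and negbK => h.
have bu : bv (bas u) = 0 by have := bv_harm (bas u); rewrite harm_bas fu.
rewrite lapE bu add0r -th_eul // -pdZ -pdB eul_bas // -scalerBl pdZ.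
case/orP: h => [tu|/eqP]; last by rewrite /deg => ->; rewrite subrr scale0r.
rewrite (_ : th (bas u) = 0) ?scaler0 //.
by case: th_bas tu => // x v [_ _ ->].
Qed.

Lemma rank_lap : \dim (limg (lapf k)) = #|rk_set|.
Proof.
have inj : (spanP rk_set :&: lker (lapf k) = 0)%VS.
  apply/eqP; rewrite -subv0; apply/subvP => z; rewrite memv_cap memv_ker lapfE.
  by case/andP=> zS /eqP z0; rewrite memv0 (lap_inj zS z0).
rewrite -dim_spanP -(limg_dim_eq inj); congr (\dim _).
apply/eqP; rewrite eqEsubv; apply/andP; split; last exact/limgS/subvf.
by apply/subvP => _ /memv_imgP[z _ ->]; apply: lap_span.
Qed.

End Rank.

(** * The dimension *)

Lemma card_mono : #|{: mono}| = (\prod_i (height i).+1 * 2 ^ n.+1)%N.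
Proof.
rewrite card_prod card_dep_ffun foldrE big_image /=; congr (_ * _)%N.
  by apply: eq_bigr => i _; rewrite card_ord.
by rewrite -cardsT -powersetT card_powerset cardsT card_ord.
Qed.

(** A class monomial is determined by its odd part, in which x_(2n+1) may freely occur or not. *)
Definition cls S : mono := mkmono p t (fun i => if widen i \in S then 0%N else
  height i) S.

Lemma expo_cls S i : expo (cls S) i = if widen i \in S then 0%N else height i.
Proof. by rewrite expo_mkmono //; case: ifP. Qed.

Lemma inC_cls S : inC (cls S).
Proof.
rewrite /inC /defect; case: pickP => // i.
by rewrite /noncoh expo_cls /=; case: (widen i \in S); rewrite eqxx.
Qed.

Lemma cls_inC u : inC u -> cls u.2 = u.
Proof.
move/eqP=> fu; apply: eq_mono => // i; rewrite expo_cls.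
by have := defect_none i fu; rewrite /noncoh; case: ifP => _ /negbFE/eqP.
Qed.

Lemma card_inC (P : pred mono) :
  #|[pred u | inC u && P u]| = #|[pred S | P (cls S)]|.
Proof.
have inj : injective cls by move=> S T [].
rewrite -(card_image inj); apply: eq_card => u; rewrite !inE.
apply/andP/imageP => [[uC Pu]|[S PS ->]]; last by rewrite inC_cls.
by exists u.2; rewrite ?inE cls_inC.
Qed.

Lemma card_with_ord_max (P : pred {set 'I_n.+1}) :
  #|[pred S : {set 'I_n.+1} | (ord_max \in S) && P (S :\ ord_max)]| =
  #|[set T in powerset [set~ ord_max] | P T]|.
Proof.
pose f S := S :\ (ord_max : 'I_n.+1).
have inj : {in [pred S : {set 'I_n.+1} | (ord_max \in S) && P (f S)] &,
  injective f}.
  move=> S T /andP[mS _] /andP[mT _] e.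
  by rewrite -(setD1K mS) -(setD1K mT) -/(f S) e.
rewrite -(card_in_image inj); apply: eq_card => T.
rewrite [RHS]inE powersetE; apply/imageP/andP => [[S /andP[mS PS] ->]|[sT PT]].
  by split=> //; apply/subsetP => s; rewrite !inE => /andP[].
have nT : ord_max \notin T by apply: contraTN sT => mT; apply/subsetPn;
  exists ord_max; rewrite ?inE ?negbK.
exists (ord_max |: T); last by rewrite /f setU1K.
by rewrite inE setU11 /f setU1K.
Qed.

Lemma card_ord_max : #|[pred S : {set 'I_n.+1} | ord_max \in S]| = (2 ^ n)%N.
Proof.
transitivity #|[pred S : {set 'I_n.+1} | (ord_max \in S) && predT (S :\
  ord_max)]|.
  by apply: eq_card => S; rewrite !inE andbT.
rewrite card_with_ord_max -[RHS](congr1 (expn 2) (_ : #|[set~ (ord_max :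
  'I_n.+1)]| = n)).
  by rewrite -card_powerset; apply: eq_card => T; rewrite !inE andbT.
by rewrite cardsC1 card_ord.
Qed.

(** An index in S contributes 1, and any other index its height, which is -1 in F. *)
Lemma deg_cls S : deg (cls S) = (2 * #|S :\ ord_max|)%N%:R - n%:R.
Proof.
have -> : #|S :\ ord_max| = (\sum_(i < n) (widen i \in S))%N.
  rewrite -sum1_card big_mkcond big_ord_recr /= !inE eqxx addn0.
  by apply: eq_bigr => i _; rewrite !inE -val_eqE /= ltn_eqF.
have -> : n%:R = \sum_(i < n) (1 : F) by rewrite sumr_const card_ord.
rewrite /deg natrM !natr_sum mulr_sumr -sumrB.
apply: eq_bigr => i _; rewrite expo_cls /=; case: (widen i \in S) => /=.
  by rewrite add0n; ring.
by rewrite addn0 height_opp1; ring.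
Qed.

Lemma card_resonant (lambda : F) :
  #|[pred u : mono | inC u && ((ord_max \in u.2) && (deg u == n%:R * lambda +
    2%:R))]| =
  (\sum_(k in S2set n lambda) 'C(n, k))%N.
Proof.
rewrite card_inC.
pose P T := (2 * #|T|)%N%:R - n%:R == n%:R * lambda + 2%:R.
transitivity #|[pred S : {set 'I_n.+1} | (ord_max \in S) && P (S :\ ord_max)]|.
  by apply: eq_card => S; rewrite !inE deg_cls.
rewrite card_with_ord_max -sum1_card.
have cT T : T \in powerset [set~ ord_max] -> (#|T| <= n)%N.
  by rewrite powersetE => /subset_leq_card; rewrite cardsC1 card_ord.
(* The index k counts the odd variables missing from T: with #|T| = n - k the resonance 2 (n - k) -
   n = c + 2 is the equation defining [S2set]. *)
pose h T : 'I_n.+1 := inord (n - #|T|).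
rewrite (partition_big h (mem (S2set n lambda))) /=; last first.
  move=> T; rewrite inE => /andP[/cT le_T PT]; rewrite inE /h inordK ?ltnS
    ?leq_subr //.
  rewrite natrM natrB // mulrBr; move/eqP: PT; rewrite natrM =>
    /(canRL (subrK _)) ->.
  by apply/eqP; ring.
apply: eq_bigr => k; rewrite inE => /eqP hk.
rewrite sum1dep_card -(bin_sub (ltn_ord k : (k <= n)%N)).
have -> : 'C(n, n - k) = 'C(#|[set~ (ord_max : 'I_n.+1)]|, n - k) by rewrite
  cardsC1 card_ord.
rewrite -cards_draws; apply: eq_card => T; rewrite !inE.
have [sT|] //= := boolP (T \subset [set~ ord_max]).
have le_T : (#|T| <= n)%N by apply: cT; rewrite powersetE.
have ltk := ltn_ord k.
rewrite -val_eqE /= inordK ?ltnS ?leq_subr //.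
apply/andP/eqP => [[_ /eqP <-]|e]; first by rewrite subKn.
rewrite e subKn -1?ltnS //; split=> //; rewrite /P e natrM natrB -1?ltnS //.
move/eqP: hk => hk; rewrite -subr_eq0; apply/eqP; rewrite -[RHS]oppr0 -(eqP hk).
by rewrite natrM; ring.
Qed.

Lemma card_pred_sum (T : finType) (P : pred T) : #|P| = (\sum_u P u)%N.
Proof. by rewrite -sum1_card big_mkcond; apply: eq_bigr => u _;
  rewrite unfold_in; case: (P u). Qed.

(** As A and B are equinumerous, #|A| + 2^n is half the number of monomials; [rk_set] adds to A the
    2^n classes containing x_(2n+1), minus the resonant ones. *)
Lemma card_rk_set (lambda : F) :
  (#|rk_set (n%:R * lambda + 2%:R)| + \sum_(k in S2set n lambda) 'C(n, k) =
   \prod_i (height i).+1 * 2 ^ n)%N.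
Proof.
set k := n%:R * lambda + 2%:R.
have cC : #|inC| = (2 ^ n.+1)%N.
  transitivity #|[pred u : mono | inC u && predT u]|.
    by apply: eq_card => u; rewrite !inE andbT.
  by rewrite card_inC -cardsT -powersetT card_powerset cardsT card_ord.
have cD : #|[pred u : mono | inC u && (ord_max \in u.2)]| = (2 ^ n)%N.
  by rewrite card_inC -card_ord_max.
have e : (#|rk_set k| + \sum_(k in S2set n lambda) 'C(n, k) =
    #|inA| + 2 ^ n)%N.
  rewrite -card_resonant -cD !card_pred_sum -!big_split; apply: eq_bigr =>
    u _ /=.
  rewrite /rk_set; case: (ABC_cases u) => _ h _.
  case: (inA u) h => [/(_ isT)/negPf ->|_] //=.
  by case: (inC u) (ord_max \in u.2) (deg u == _) => -[] [].
have := card_ABC; rewrite -card_A_B cC card_mono expnS.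
by rewrite e => /eqP; rewrite addnn -mul2n -mulnDr mulnCA eqn_pmul2l // => /eqP.
Qed.

End Operators.

(** * Elementary symmetric sums and the closed formula *)

Lemma sum_incr_tuples (n l : nat) (x : 'I_n -> int) :
  \sum_(J : {set 'I_n} | #|J| == l) \prod_(j in J) x j =
  \sum_(s in incr_tuples n l) \prod_(c < l) x (tnth s c).
Proof.
pose f (s : l.-tuple 'I_n) := [set i in s].
have incr_uniq (s : l.-tuple 'I_n) : s \in incr_tuples n l -> uniq s.
  rewrite inE -(map_inj_uniq val_inj); exact: (sorted_uniq ltn_trans ltnn).
have inj : {in incr_tuples n l &, injective f}.
  move=> s s'; rewrite !inE => ss ss' e; apply: val_inj;
    apply: (inj_map val_inj).
  apply: (irr_sorted_eq ltn_trans ltnn) => // k.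
  have es i : (i \in s) = (i \in s') by have := congr1 (fun A : {set _} =>
    i \in A) e; rewrite !inE.
  by apply/mapP/mapP => -[i si ->]; exists i; rewrite ?es // -es.
have -> : \sum_(J : {set 'I_n} | #|J| == l) \prod_(j in J) x j =
    \sum_(J in f @: incr_tuples n l) \prod_(j in J) x j.
  apply: eq_bigl => J; apply/idP/imsetP => [cJ|[s ss ->]]; last first.
    by rewrite cardsE (card_uniqP (incr_uniq _ ss)) size_tuple.
  have sz : size (enum J) == l by rewrite -cardE.
  exists (Tuple sz); last by apply/setP => i; rewrite inE mem_enum.
  rewrite inE /= -[enum _](eq_filter (mem_enum _)).
  rewrite -(eq_filter (mem_map val_inj _)) -filter_map.
  by rewrite (sorted_filter ltn_trans) // unlock val_ord_enum iota_ltn_sorted.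
rewrite big_imset //=; apply: eq_bigr => s ss.
rewrite -(big_tuple _ _ s xpredT x) (big_uniq _ (incr_uniq _ ss)) /=.
by apply: eq_bigl => i; rewrite inE.
Qed.

Lemma prod_addr_incr_tuples (n : nat) (x : 'I_n -> int) (y : int) :
  \prod_(j < n) (x j + y) =
  \sum_(l < n.+1) y ^+ (n - l) *
     \sum_(s in incr_tuples n l) \prod_(c < l) x (tnth s c).
Proof.
have le_card (J : {set 'I_n}) : (#|J| <= n)%N.
  by rewrite (leq_trans (max_card _)) ?card_ord.
rewrite bigA_distr.
transitivity (\sum_(J : {set 'I_n}) y ^+ (n - #|J|) * \prod_(j in J) x j).
  apply: eq_bigr => J _; rewrite (bigID (mem J)) /= mulrC; congr (_ * _).
    rewrite (eq_bigr (fun=> y)) => [|i /negPf -> //].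
    rewrite prodr_const; congr (_ ^+ _); apply: (@addnI #|J|).
    by rewrite subnKC //; apply: etrans (cardC J) (card_ord n).
  by apply: eq_bigr => i ->.
rewrite (partition_big (fun J : {set 'I_n} => Ordinal (le_card J : #|J| <
  n.+1)%N) predT) //=.
apply: eq_bigr => l _; rewrite -sum_incr_tuples mulr_sumr.
by apply: eq_big => [J|J /eqP <-] //; rewrite -val_eqE.
Qed.

(** Taken over all l from 0, the sum would be 2^(n - 1) times the product of the x_j + 1 minus that
    of the x_j + 2. The omitted terms are 0 for l = 1 and 2^(n - 1) - 2^n for l = 0, whence the last
    summand. *)
Lemma incr_tuples_formula (n : nat) (x : 'I_n -> int) : (0 < n)%N ->
  \sum_(2 <= l < n.+1) (2 ^+ (n - 1) - 2 ^+ (n - l)) *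
     (\sum_(s in incr_tuples n l) \prod_(c < l) x (tnth s c)) +
  \prod_(j < n) (x j + 2) = 2 ^+ (n - 1) * \prod_(j < n) (x j + 1) + 2 ^+ (n -
    1) :> int.
Proof.
move=> n0; pose e l := \sum_(s in incr_tuples n l) \prod_(c < l) x (tnth s c).
have e0 : e 0%N = 1.
  rewrite /e (big_pred1 [tuple]) => [|s]; first by rewrite big_ord0.
  by rewrite [s]tuple0 inE /= eq_refl.
have -> : \prod_(j < n) (x j + 2) = \sum_(0 <= l < n.+1) 2 ^+ (n - l) * e l.
  by rewrite big_mkord; apply: prod_addr_incr_tuples.
have -> : \prod_(j < n) (x j + 1) = \sum_(0 <= l < n.+1) e l.
  rewrite big_mkord prod_addr_incr_tuples; apply: eq_bigr => l _.
  by rewrite expr1n mul1r.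
have split2 (g : nat -> int) :
    \sum_(0 <= l < n.+1) g l = g 0%N + (g 1%N + \sum_(2 <= l < n.+1) g l).
  by rewrite big_ltn // big_ltn.
rewrite !split2 e0 !mulrDr.
rewrite (eq_bigr (fun l => 2 ^+ (n - 1) * e l - 2 ^+ (n - l) * e l));
  last first.
  by move=> l _; rewrite mulrBl.
rewrite sumrB -mulr_sumr subn0; have -> : (2 ^+ n = 2 * 2 ^+ (n - 1) :> int).
  by rewrite -exprS subn1 prednK.
ring.
Qed.

Theorem theorem3p2 (F : fieldType) (p n : nat) (t : 'I_n -> nat) (lambda : F)
    (p_char : p \in [pchar F]) (p_gt3 : (3 < p)%N) (n_ge3 : (3 <= n)%N)
    (t_gt0 : forall i, (0 < t i)%N) :
  (\dim (SKO p t lambda))%:Z =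
    2 * (\sum_(2 <= l < n.+1)
            (2 ^+ (n - 1) - 2 ^+ (n - l)) *
            (\sum_(s in incr_tuples n l)
                \prod_(c < l) (height p t (tnth s c))%:Z)
         + \prod_(j < n) ((height p t j)%:Z + 2))
    - \sum_(k in S2set n lambda) ('C(n, k))%:Z
    - 2 ^+ n - (delta' n lambda)%:Z.
Proof.
have p_gt2 : (2 < p)%N by exact: ltnW.
have n_gt1 : (1 < n)%N by exact: ltnW.
have eS : SKO p t lambda = (DKO F p t @: koimg p t (n%:R * lambda))%VS.
  apply/eqP; rewrite eqEsubv SKO_sub //=; apply: sub_SKO => // B hB.
  exact: koimg_sub.
have dS : \dim (DKO F p t @: koimg p t (n%:R * lambda)) = \dim (koimg p t (n%:R
  * lambda)).
  by apply: limg_dim_eq; rewrite lker_DKO // capv0.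
have := card_rk_set p_char p_gt2 t_gt0 lambda.
rewrite -rank_lap // -(dim_koimg p_char p_gt2 t_gt0) -dS -eS -/(delta' n
  lambda).
move=> /(congr1 Posz); rewrite !PoszD PoszM (big_morph Posz PoszM erefl).
rewrite (big_morph Posz PoszD erefl) -[X in _ * X]natz natrX.
rewrite (incr_tuples_formula (fun j => (height p t j)%:Z)) ?(ltnW n_gt1) //.
rewrite (eq_bigr (fun j => (height p t j)%:Z + 1)) => [e|j _];
  last by rewrite -PoszD addn1.
have -> : (\dim (SKO p t lambda))%:Z = \prod_(j < n) ((height p t j)%:Z + 1) *
  2 ^+ n
    - \sum_(k in S2set n lambda) ('C(n, k))%:Z - (delta' n lambda)%:Z.
  by rewrite -e; ring.
have -> : (2 ^+ n = 2 * 2 ^+ (n - 1) :> int) by rewrite -exprS subn1 prednK //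
  (ltnW n_gt1).
ring.
Qed.
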